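(* Let $\alpha>1$, $m_0\in\mathcal P_\alpha(\mathbb R^d)$, $R\ge R(\alpha,[m_0]_\alpha)$, let $\eta\in\mathcal P_{m_0}(\Gamma_T,R)$ be a Mean Field Games equilibrium for $m_0$, and let $V$ be the value function associated with $\eta$. Assume in addition that there exist constants $w_L,w_G\ge0$ such that for all $\lambda\in[0,1]$, all $r>0$, all $u\in\mathbb R^k$, all $x_0,x_1\in B_r$ and all $m\in\mathcal P_1(\mathbb R^d)$, $$\lambda L(x_0,u,m)+(1-\lambda)L(x_1,u,m)-L(\lambda x_0+(1-\lambda)x_1,u,m)\le w_L\lambda(1-\lambda)|x_0-x_1|^2,$$ $$\lambda G(x_0,m)+(1-\lambda)G(x_1,m)-G(\lambda x_0+(1-\lambda)x_1,m)\le w_G\lambda(1-\lambda)|x_0-x_1|^2.$$ Then for every radius $\rho>0$ there exists a constant $\Lambda\ge0$ such that for any $(t,x)\in[0,T]\times\overline B_\rho$ and any $(h,\delta)\in\mathbb R^d\times\mathbb R$ such that $(t+\delta,x+h)\in[0,T]\times\overline B_\rho$ and $(t-\delta,x-h)\in[0,T]\times\overline B_\rho$, $$V(t+\delta,x+h)+V(t-\delta,x-h)-2V(t,x)\le\Lambda\big(|h|^2+|\delta|^{3/2}\big).$$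
   Context: $B_r$ is the open ball of radius $r$ centered at $0$ in $\mathbb R^d$. Data: $T>0$; real matrices $A$ ($d\times d$) and $B$ ($d\times k$). $\mathcal P_p(\mathbb R^d)$ is the set of Borel probability measures on $\mathbb R^d$ with finite $p$-th moment and $d_1$ is the Kantorovich–Rubinstein (1-Wasserstein) distance. $L:\mathbb R^d\times\mathbb R^k\times\mathcal P_1(\mathbb R^d)\to\mathbb R$ and $G:\mathbb R^d\times\mathcal P_1(\mathbb R^d)\to\mathbb R$ satisfy the standing assumptions: (1) for each $m$, $(x,u)\mapsto L(x,u,m)$ is $C^2$, and $m\mapsto L(x,u,m)$ is $d_1$-Lipschitz with a constant independent of $(x,u)$; (2) $G$ is bounded and uniformly continuous on $\mathbb R^d\times\mathcal P_1(\mathbb R^d)$, and for each $m$, $x\mapsto G(x,m)$ is in $C^1_b(\mathbb R^d)$ (bounded with bounded uniformly continuous first derivatives); (3) there are constants $C_0>0$, $C_1,C_2\ge0$ such that for all $(x,u,m)$: $\frac{1}{C_0}\mathrm{Id}\le D^2_{uu}L(x,u,m)\le C_0\mathrm{Id}$, $\|D^2_{xu}L(x,u,m)\|\le C_1(1+|u|)$, and $|L(x,0,m)|+|D_xL(x,0,m)|+|D_uL(x,0,m)|\le C_2$. For $x\in\mathbb R^d$ and $u\in L^1(0,T;\mathbb R^k)$, $\gamma(\cdot;x,u)$ is the solution of $\dot\gamma=A\gamma+Bu$ on $[0,T]$, $\gamma(0)=x$. $\Gamma_T$ is the set of all such curves, with the uniform norm, and $e_t(\gamma)=\gamma(t)$.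 Let $[m_0]_\alpha=\int|x|^\alpha\,m_0(dx)$. For $R\ge[m_0]_\alpha$, $$\mathcal P_{m_0}(\Gamma_T,R)=\Big\{\eta\in\mathcal P(\Gamma_T):\int_{\Gamma_T}\|\dot\gamma\|_{2}^\alpha\,\eta(d\gamma)\le R,\ e_0\sharp\eta=m_0\Big\},$$ where $\|\cdot\|_2$ is the $L^2(0,T)$ norm. For $\eta$ in this set, let $m^\eta_t=e_t\sharp\eta$, $J_\eta(x,u)=\int_0^TL(\gamma(t;x,u),u(t),m^\eta_t)\,dt+G(\gamma(T;x,u),m^\eta_T)$, and let $\Gamma^*_\eta(x)$ be the set of curves $\gamma(\cdot;x,u^* )$ where $u^*$ minimizes $J_\eta(x,\cdot)$ over $L^2(0,T;\mathbb R^k)$. A Mean Field Games equilibrium for $m_0$ is an $\eta\in\mathcal P_{m_0}(\Gamma_T,R)$ with $\operatorname{supp}(\eta)\subset\bigcup_{x\in\mathbb R^d}\Gamma^*_\eta(x)$. The value function associated with $\eta$ is $$V(t,x)=\inf_{u\in L^2(t,T;\mathbb R^k)}\Big\{\int_t^TL(\gamma(s;t,x,u),u(s),m^\eta_s)\,ds+G(\gamma(T;t,x,u),m^\eta_T)\Big\},$$ where $\gamma(\cdot;t,x,u)$ solves $\dot\gamma=A\gamma+Bu$ on $[t,T]$, $\gamma(t)=x$. $R(\alpha,[m_0]_\alpha)\ge[m_0]_\alpha$ denotes a positive constant such that, for every $R\ge R(\alpha,[m_0]_\alpha)$, the set $\mathcal P_{m_0}(\Gamma_T,R)$ is non-empty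 and for every $\eta$ in it there is $\nu\in\mathcal P_{m_0}(\Gamma_T,R)$ whose disintegration $\nu(d\gamma)=\int\nu_x(d\gamma)m_0(dx)$ with respect to $e_0$ satisfies $\operatorname{supp}(\nu_x)\subset\Gamma^*_\eta(x)$ for $m_0$-a.e. $x$ (such a constant exists). *)

(* Defs.v *)
From HB Require Import structures.
From mathcomp Require Import all_boot all_order all_algebra.
From mathcomp Require Import all_classical all_reals all_analysis.

Set Implicit Arguments.
Unset Strict Implicit.
Unset Printing Implicit Defensive.
Import Order.TTheory GRing.Theory Num.Theory.
Import numFieldNormedType.Exports.
Local Open Scope classical_set_scope.
Local Open Scope ring_scope.

Notation borel X := (g_sigma_algebraType (@open X)).

Section euclidean.
Context {R : realType}.

(* Euclidean norm: the library norm on matrices is the sup norm. *)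
Definition enorm n (x : 'cV[R]_n) : R := Num.sqrt (\sum_i x i 0 ^+ 2).

Definition opnorm p q (M : 'M[R]_(p, q)) : R :=
  sup [set enorm (M *m v) | v in [set v : 'cV[R]_q | enorm v <= 1]].

Definition qform n (M : 'M[R]_n) (v : 'cV[R]_n) : R := (v^T *m M *m v) 0 0.

End euclidean.

Section smoothness.
Context {R : realType}.

(* [V] is meant to be finite dimensional: continuity of every directional
   derivative is then continuity of the differential. *)
Definition C1 (V : normedModType R) (f : V -> R) : Prop :=
  (forall z, differentiable f z) /\ (forall v, continuous ('D_v f)).

Definition C2 (V : normedModType R) (f : V -> R) : Prop :=
  C1 f /\ (forall v, C1 ('D_v f)).

Definition C1b n (f : 'cV[R]_n -> R) : Prop :=
  [/\ forall x, differentiable f x,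
      exists c : R, forall x, `|f x| <= c &
      forall v, (exists c : R, forall x, `|'D_v f x| <= c) /\
                unif_continuous ('D_v f)].

Context {d k : nat}.
Implicit Type f : 'cV[R]_d * 'cV[R]_k -> R.

Definition dirx (i : 'I_d) : 'cV[R]_d * 'cV[R]_k := (delta_mx i 0, 0).
Definition diru (j : 'I_k) : 'cV[R]_d * 'cV[R]_k := (0, delta_mx j 0).

Definition gradx f z : 'cV[R]_d := \col_i 'D_(dirx i) f z.
Definition gradu f z : 'cV[R]_k := \col_j 'D_(diru j) f z.
Definition hess_uu f z : 'M[R]_k := \matrix_(i, j) 'D_(diru i) ('D_(diru j) f) z.
Definition hess_xu f z : 'M[R]_(d, k) :=
  \matrix_(i, j) 'D_(dirx i) ('D_(diru j) f) z.

End smoothness.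

Section wasserstein.
Context {R : realType} {n : nat}.
Local Notation P := (probability (borel 'cV[R]_n) R).

Definition moment (p : R) (m : P) : \bar R :=
  (\int[m]_x (enorm (x : 'cV[R]_n) `^ p)%:E)%E.

Definition finite_moment (p : R) : set P := [set m | (moment p m < +oo)%E].

Definition coupling (m m' : P) :
    set (probability (borel 'cV[R]_n * borel 'cV[R]_n)%type R) :=
  [set pi | forall E, measurable E ->
     pi (E `*` setT) = m E /\ pi (setT `*` E) = m' E].

Definition d1 (m m' : P) : \bar R :=
  ereal_inf [set (\int[pi]_z (enorm ((z.1 : 'cV[R]_n) - z.2))%:E)%E
            | pi in coupling m m'].

End wasserstein.

Section controlled_system.
Context {R : realType} {d k : nat}.
Variables (A : 'M[R]_d) (B : 'M[R]_(d, k)).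
Local Notation mu := (@lebesgue_measure R).

Definition Lp_control (p a b : R) (u : R -> 'cV[R]_k) : Prop :=
  (forall j, measurable_fun `[a, b] (fun s => u s j 0)) /\
  (\int[mu]_(s in `[a, b]) (enorm (u s) `^ p)%:E < +oo)%E.

Definition vec_integral n (a b : R) (f : R -> 'cV[R]_n) : 'cV[R]_n :=
  \col_i \int[mu]_(s in `[a, b]) (f s i 0).

(* Caratheodory solution on [t, T] of g' = A g + B u, g(t) = x; nothing is
   required of g outside [t, T]. *)
Definition trajectory (t T : R) (x : 'cV[R]_d) (u : R -> 'cV[R]_k)
    (g : R -> 'cV[R]_d) : Prop :=
  {within `[t, T], continuous g} /\
  forall s, s \in `[t, T] ->
    g s = x + vec_integral t s (fun r => A *m g r + B *m u r).

(* Curves on [0, T] are encoded as functions on R vanishing outside [0, T], so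
   that each curve has exactly one representative. *)
Definition Gamma (T : R) : set (R -> 'cV[R]_d) :=
  [set g | (forall s, s \notin `[0, T] -> g s = 0) /\
           exists x u, Lp_control 1 0 T u /\ trajectory 0 T x u g].

Lemma Gamma0 T : Gamma T (fun=> 0).
Proof.
split=> //; exists 0, (fun=> 0); split; first split.
- by move=> j; exact: measurable_cst.
- rewrite (_ : (fun s => _) = cst 0%E) ?integral0//.
  apply/funext => s; rewrite /enorm (_ : \sum_i _ = 0) ?sqrtr0 ?powRr1//.
  by rewrite big1// => i _; rewrite mxE expr0n.
- split; first by apply: continuous_subspaceT => s; exact: cvg_cst.
  move=> s _; apply/colP => i; rewrite !mxE add0r.
  rewrite /Rintegral (eq_integral (cst 0%E)) ?integral0// => r _.
  by rewrite !big1 ?addr0// => j _; rewrite mxE mulr0.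
Qed.

Definition curve (T : R) : Type := set_type (Gamma T).

Definition curve_fun T (g : curve T) : {uniform` `[0, T] -> 'cV[R]_d} :=
  \val g.

HB.instance Definition _ T := Choice.on (curve T).
HB.instance Definition _ T :=
  isPointed.Build (curve T) (SigSub (mem_set (Gamma0 T))).
HB.instance Definition _ T :=
  Topological.copy (curve T) (initial_topology (@curve_fun T)).

End controlled_system.

Section mean_field_game.
Context {R : realType} {d k : nat}.
Variables (A : 'M[R]_d) (B : 'M[R]_(d, k)) (T : R).
Local Notation mu := (@lebesgue_measure R).
Local Notation P := (probability (borel 'cV[R]_d) R).
Local Notation C := (borel (curve A B T)).

Definition eval (t : R) : C -> borel 'cV[R]_d :=
  fun g => (\val g : R -> 'cV[R]_d) t.

Lemma continuous_eval t :
  continuous (fun g : curve A B T => (\val g : R -> 'cV[R]_d) t).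
Proof.
have [tT|tT] := boolP (t \in `[0, T]); last first.
  suff -> : (fun g : curve A B T => (\val g : R -> 'cV[R]_d) t) = cst 0.
    exact: cst_continuous.
  by apply/funext => -[g gG] /=; have [-> //] := set_mem gG.
move=> g.
have := @initial_continuous _ _ (@curve_fun R d k A B T) g.
move=> cvg_g U; rewrite -nbhs_entourageE => -[E entE EU].
apply: (cvg_g [set f | U (f t)]).
apply/uniform_nbhs; exists E; split => //= f Ef; apply: EU.
by apply/mem_set; apply: Ef; rewrite /= inE.
Qed.

Lemma measurable_eval t : measurable_fun setT (eval t).
Proof.
apply: (@measurability _ _ _ _ setT (eval t) (@open 'cV[R]_d)) => //.
move=> _ [U oU <-]; rewrite setTI; apply: sub_sigma_algebra.
by move/continuousP : (@continuous_eval t); exact.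
Qed.

HB.instance Definition _ t :=
  isMeasurableFun.Build _ _ C (borel 'cV[R]_d) (eval t) (measurable_eval t).

Definition flow (eta : probability C R) (t : R) : P := distribution eta (eval t).

Definition supp (eta : {measure set C -> \bar R}) : set (curve A B T) :=
  [set g | forall U : set (curve A B T), open U -> U g -> (0 < eta U)%E].

(* Curves are absolutely continuous, so ['D_1] is their derivative almost
   everywhere. *)
Definition deriv_norm2 (g : curve A B T) : \bar R :=
  ((\int[mu]_(s in `[0%R, T])
      (enorm ('D_1 (\val g : R -> 'cV[R]_d) s) ^+ 2)%:E) `^ (1 / 2)%R)%E.

Definition curve_measures (alpha : R) (m0 : P) (r : R) :
    set (probability C R) :=
  [set eta : probability C R |
     (\int[eta]_g (deriv_norm2 g `^ alpha) <= r%:E)%E /\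
     forall E, measurable E -> flow eta 0 E = m0 E].

Variables (L : 'cV[R]_d -> 'cV[R]_k -> P -> R) (G : 'cV[R]_d -> P -> R).

Definition cost (m : R -> P) (t : R) (u : R -> 'cV[R]_k)
    (g : R -> 'cV[R]_d) : R :=
  (\int[mu]_(s in `[t, T]) L (g s) (u s) (m s)) + G (g T) (m T).

Definition value (eta : probability C R) (t : R) (x : 'cV[R]_d) : R :=
  inf [set c | exists u g, [/\ Lp_control 2 t T u, trajectory A B t T x u g &
                              c = cost (flow eta) t u g]].

Definition optimal_curves (eta : probability C R) (x : 'cV[R]_d) :
    set (curve A B T) :=
  [set g | exists u,
    [/\ Lp_control 2 0 T u, trajectory A B 0 T x u (\val g) &
        forall u' g', Lp_control 2 0 T u' -> trajectory A B 0 T x u' g' ->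
          cost (flow eta) 0 u (\val g) <= cost (flow eta) 0 u' g']].

Definition mfg_equilibrium (alpha : R) (m0 : P) (r : R)
    (eta : probability C R) : Prop :=
  curve_measures alpha m0 r eta /\
  supp eta `<=` \bigcup_x optimal_curves eta x.

Definition disintegration (nu : probability C R) (m0 : P)
    (nux : R.-pker (borel 'cV[R]_d) ~> C) : Prop :=
  (forall E, measurable E -> nu E = (\int[m0]_x nux x E)%E) /\
  {ae m0, forall x, nux x (eval 0 @^-1` [set x]) = 1%E}.

Definition invariance_threshold (alpha : R) (m0 : P) (r0 : R) : Prop :=
  [/\ 0 < r0, (moment alpha m0 <= r0%:E)%E &
   forall r, r0 <= r ->
     curve_measures alpha m0 r !=set0 /\
     forall eta, curve_measures alpha m0 r eta ->
       exists2 nu, curve_measures alpha m0 r nu &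
       exists2 nux, disintegration nu m0 nux &
         {ae m0, forall x, supp (nux x) `<=` optimal_curves eta x}].

End mean_field_game.

Section assumptions.
Context {R : realType} {d k : nat}.
Local Notation P := (probability (borel 'cV[R]_d) R).
Local Notation P1 := (@finite_moment R d 1).
Variables (L : 'cV[R]_d -> 'cV[R]_k -> P -> R) (G : 'cV[R]_d -> P -> R).

Definition Lxu (m : P) : 'cV[R]_d * 'cV[R]_k -> R := fun z => L z.1 z.2 m.

(* L and G are total in the measure argument; only their restrictions to P1
   are constrained, here and in [semiconcave_data]. *)
Record standing_assumptions : Prop := StandingAssumptions {
  L_C2 : forall m, P1 m -> C2 (Lxu m);
  L_lipschitz : exists2 c : R, 0 <= c & forall x u m m', P1 m -> P1 m' ->
    (`|L x u m - L x u m'|%:E <= c%:E * d1 m m')%E;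
  G_bounded : exists c : R, forall x m, P1 m -> `|G x m| <= c;
  G_unif_continuous : forall e : R, 0 < e -> exists2 a : R, 0 < a &
    forall x x' m m', P1 m -> P1 m' -> enorm (x - x') < a ->
      (d1 m m' < a%:E)%E -> `|G x m - G x' m'| < e;
  G_C1b : forall m, P1 m -> C1b (G ^~ m);
  L_growth : exists c0 c1 c2 : R, [/\ 0 < c0, 0 <= c1, 0 <= c2 &
    forall x u m, P1 m ->
    [/\ forall v, c0^-1 * enorm v ^+ 2 <= qform (hess_uu (Lxu m) (x, u)) v
                  <= c0 * enorm v ^+ 2,
        opnorm (hess_xu (Lxu m) (x, u)) <= c1 * (1 + enorm u) &
        `|L x 0 m| + enorm (gradx (Lxu m) (x, 0)) +
          enorm (gradu (Lxu m) (x, 0)) <= c2]]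
}.

Definition semiconcave_data (wL wG : R) : Prop :=
  forall (lam r : R) (u : 'cV[R]_k) (x0 x1 : 'cV[R]_d) (m : P),
    0 <= lam <= 1 -> 0 < r -> enorm x0 < r -> enorm x1 < r -> P1 m ->
    lam * L x0 u m + (1 - lam) * L x1 u m
      - L (lam *: x0 + (1 - lam) *: x1) u m
      <= wL * lam * (1 - lam) * enorm (x0 - x1) ^+ 2 /\
    lam * G x0 m + (1 - lam) * G x1 m - G (lam *: x0 + (1 - lam) *: x1) m
      <= wG * lam * (1 - lam) * enorm (x0 - x1) ^+ 2.

End assumptions.

(* Main.v *)
(** The value function is semiconcave in space, uniformly in time: shifting a
    near-optimal trajectory from [x] by [exp(s A) h] and [- exp(s A) h] with the
    same control costs at most [O(|h|^2)]. It is also Lipschitz in space, because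
    a bounded function that is semiconcave at all scales is Lipschitz.

    In time, comparison with the null control over [[t, t + e]] shows that a
    near-optimal control [u] satisfies [int_t^{t+e} (1 + |u|^2) = O(e)]. Starting
    from [x - h] at time [t - e], run [u], restricted to [[t, t + e]], twice in a
    row. The curve [s |-> m_s] is 1/2-Hoelder for [d1], since the curves have
    mean square integrable velocity; so translating the running cost by [e] in
    time costs [O(e^{3/2})], and the spatial error terms are [O(e^2 + |h|^2)] by
    Young's inequality. At time [t + e] the two end points are symmetric up to
    such errors about the end point of [u], and semiconcavity in space
    concludes. *)

Require Import Defs.
From HB Require Import structures.
From mathcomp Require Import all_boot all_order all_algebra.
From mathcomp Require Import all_classical all_reals all_analysis.
From mathcomp Require Import measurable_realfun.
From mathcomp Require Import ring lra.
Set Implicit Arguments.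
Unset Strict Implicit.
Unset Printing Implicit Defensive.
Import Order.TTheory GRing.Theory Num.Theory.
Import numFieldNormedType.Exports.
Local Open Scope classical_set_scope.
Local Open Scope ring_scope.

(** * Vectors and integrals over intervals *)

(** No minimizer has to exist: a control within [e ^+ 2] of the infimum suffices, because e^2 <=
    e^(3/2) for e <= 1. Such a control has no pointwise bound, so all errors carry the weight 1 +
    |u|^2 and only its energy on [t, t + e] is estimated. Running it twice keeps the control
    argument of L unchanged; only the state and the measure move.

    The passage from bounded and semiconcave to Lipschitz is made for the data: at fixed u, a Taylor
    expansion in u bounds the oscillation of L in x by O(1 + |u|^2), hence its Lipschitz constant in
    x as well. The value function inherits a Lipschitz bound by shifting near-optimal trajectories,
    whose energy on [t, T] is bounded. The short-time energy estimate relies on this bound, and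
    there [rho] enters: the uncontrolled drift over time e is proportional to e |x|.

    Large time increments are covered by boundedness of the value function. The control problem is
    treated for an abstract time-dependent cost and in the sup norm; passing from the Euclidean norm
    costs factors d + 1. *)

Section norms.
Context {R : realType}.

Lemma normr_cV_le n (x : 'cV[R]_n) (c : R) : 0 <= c ->
  (forall i, `|x i 0| <= c) -> `|x| <= c.
Proof.
move=> c0 H; rewrite /Num.norm/= mx_normrE; apply: bigmax_le => // -[i j] _ /=.
by rewrite (ord1 j).
Qed.

Lemma normr_coord_le n (x : 'cV[R]_n) i : `|x i 0| <= `|x|.
Proof. by rewrite [leRHS]/Num.norm/= mx_normrE; exact: (le_bigmax _ _ (i, 0)). Qed.

Lemma enorm_ge0 n (x : 'cV[R]_n) : 0 <= enorm x.
Proof. exact: sqrtr_ge0. Qed.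

Lemma sum_sqr_ge0 n (x : 'cV[R]_n) : 0 <= \sum_i x i 0 ^+ 2.
Proof. by apply: sumr_ge0 => i _; exact: sqr_ge0. Qed.

Lemma sqr_enorm n (x : 'cV[R]_n) : enorm x ^+ 2 = \sum_i x i 0 ^+ 2.
Proof. by rewrite sqr_sqrtr// sum_sqr_ge0. Qed.

Lemma normr_le_enorm n (x : 'cV[R]_n) : `|x| <= enorm x.
Proof.
apply: normr_cV_le (enorm_ge0 _) _ => i.
rewrite -ler_sqr ?nnegrE ?enorm_ge0// sqr_enorm real_normK ?num_real//.
by rewrite (bigD1 i)//= lerDl; apply: sumr_ge0 => j _; exact: sqr_ge0.
Qed.

(** The square root of n would do; [n.+1] stays positive in dimension 0, so that one may divide by
    it. *)
Lemma enorm_le_normr n (x : 'cV[R]_n) : enorm x <= n.+1%:R * `|x|.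
Proof.
rewrite -ler_sqr ?nnegrE ?mulr_ge0 ?enorm_ge0// sqr_enorm exprMn.
apply: (@le_trans _ _ (\sum_(i < n) `|x| ^+ 2)).
  apply: ler_sum => i _; rewrite -(real_normK (num_real _)).
  by rewrite lerXn2r ?nnegrE// normr_coord_le.
rewrite sumr_const card_ord -[leLHS]mulr_natl ler_wpM2r ?sqr_ge0//.
by rewrite -natrX ler_nat (leq_trans (leqnSn n))// -{1}(expn1 n.+1) leq_pexp2l.
Qed.

Lemma enorm0 n : enorm (0 : 'cV[R]_n) = 0.
Proof. by rewrite /enorm big1 ?sqrtr0// => i _; rewrite mxE expr0n. Qed.

Lemma enormN n (x : 'cV[R]_n) : enorm (- x) = enorm x.
Proof. by congr Num.sqrt; apply: eq_bigr => i _; rewrite mxE sqrrN. Qed.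

Definition mx_bound p q (M : 'M[R]_(p, q)) : R := q%:R * `|M|.

Lemma mx_bound_ge0 p q (M : 'M[R]_(p, q)) : 0 <= mx_bound M.
Proof. by rewrite mulr_ge0. Qed.

Lemma normr_mulmx_le p q (M : 'M[R]_(p, q)) (x : 'cV[R]_q) :
  `|M *m x| <= mx_bound M * `|x|.
Proof.
apply: normr_cV_le => [|i]; first by rewrite mulr_ge0 ?mx_bound_ge0.
rewrite mxE (le_trans (ler_norm_sum _ _ _))//.
apply: (@le_trans _ _ (\sum_(j < q) `|M| * `|x|)).
  apply: ler_sum => j _; rewrite normrM ler_pM ?normr_coord_le//.
  by rewrite [leRHS]/Num.norm/= mx_normrE; exact: (le_bigmax _ _ (i, j)).
by rewrite sumr_const card_ord /mx_bound -[leLHS]mulr_natl mulrA.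
Qed.

End norms.

Section interval_integral.
Context {R : realType}.
Local Notation mu := (@lebesgue_measure R).
Implicit Types (a b c e : R) (f g : R -> R).

Definition translate e : R -> R := fun s => s + e.

Lemma measurable_translate e :
  measurable_fun setT (translate e : measurableTypeR R -> measurableTypeR R).
Proof. by apply: measurable_funD => //; exact: measurable_cst. Qed.

Lemma preimage_translate e a b (b0 b1 : bool) :
  translate e @^-1` [set` Interval (BSide b0 a) (BSide b1 b)] =
  [set` Interval (BSide b0 (a - e)) (BSide b1 (b - e))].
Proof.
apply/seteqP; split => s /=; rewrite /translate !in_itv/= => /andP[h1 h2];
  apply/andP; split; move: b0 b1 h1 h2 => [] [] /= h1 h2; lra.
Qed.

(** The image measure gives half-open intervals their length, and this characterizes Lebesgue
    measure. *)
Lemma lebesgue_measure_translate e (E : set R) : measurable E ->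
  pushforward mu (translate e : _ -> measurableTypeR R) E = mu E.
Proof.
move=> mE; apply/esym.
pose f : measurableTypeR R -> measurableTypeR R := translate e.
have mf := measurable_translate e.
pose mf' := isMeasurableFun.Build _ _ _ _ _ mf.
pose F : {mfun measurableTypeR R >-> measurableTypeR R} := HB.pack f mf'.
apply: (@lebesgue_measure_unique R (pushforward mu F)) => //= _ [[a b]] _ <-.
rewrite /pushforward preimage_translate/= !lebesgue_measure_itv/=.
rewrite !lte_fin ltrD2r; case: ifPn => // _.
by rewrite -!EFinB; congr EFin; lra.
Qed.

Lemma ge0_integral_translate e (f : R -> \bar R) (D : set R) : measurable D ->
  measurable_fun D f -> (forall s, D s -> 0 <= f s)%E ->
  (\int[mu]_(s in D) f s = \int[mu]_(s in translate e @^-1` D) f (s + e)%R)%E.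
Proof.
move=> mD mf f0.
have := @ge0_integral_pushforward _ _ _ _ R _ (measurable_translate e) mu D f mD mf.
rewrite /comp /translate => <-; last by move=> s /set_mem; exact: f0.
apply: eq_measure_integral => //= [|mt E mE _].
  exact: measurable_translate.
exact/esym/lebesgue_measure_translate.
Qed.

Lemma integral_translate e (f : R -> \bar R) (D : set R) : measurable D ->
  measurable_fun D f ->
  (\int[mu]_(s in D) f s = \int[mu]_(s in translate e @^-1` D) f (s + e)%R)%E.
Proof.
move=> mD mf; rewrite integralE [RHS]integralE; congr (_ - _)%E.
- have := @ge0_integral_translate e (funepos f) D mD.
  move=> ->//; last exact: measurable_funepos.
  by apply: eq_integral => s _; rewrite !funeposE.
- have := @ge0_integral_translate e (funeneg f) D mD.
  move=> ->//; last exact: measurable_funeneg.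
  by apply: eq_integral => s _; rewrite !funenegE.
Qed.

Lemma measurable_fun_translate d (X : measurableType d) e (f : R -> X) a b :
  measurable_fun `[a, b] f ->
  measurable_fun `[a - e, b - e] (fun s => f (s + e)).
Proof.
move=> mf.
apply: (@measurable_comp _ _ _ _ _ _ `[a, b] f `[a - e, b - e] (translate e)) => //.
  by move=> _ /= [s + <-]; rewrite !in_itv/= /translate => /andP[? ?]; lra.
exact: measurable_funTS (measurable_translate e).
Qed.

Lemma Rintegral_translate e f a b : measurable_fun `[a, b] f ->
  \int[mu]_(s in `[a - e, b - e]) f (s + e) = \int[mu]_(s in `[a, b]) f s.
Proof.
move=> mf; rewrite /Rintegral (@integral_translate e _ `[a, b])//; last first.
  exact/measurable_EFinP.
by rewrite preimage_translate.
Qed.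

Lemma integrable_translate e f a b : mu.-integrable `[a, b] (EFin \o f) ->
  mu.-integrable `[a - e, b - e] (EFin \o (fun s => f (s + e))).
Proof.
move=> /integrableP[mf foo]; apply/integrableP; split.
  apply/measurable_EFinP; apply: measurable_fun_translate.
  exact/measurable_EFinP.
move: foo; rewrite (@integral_translate e _ `[a, b]) ?preimage_translate//.
exact: measurableT_comp.
Qed.

Lemma Rintegral_itv_split f a c b : a <= c -> c <= b ->
  mu.-integrable `[a, b] (EFin \o f) ->
  \int[mu]_(s in `[a, b]) f s =
  \int[mu]_(s in `[a, c]) f s + \int[mu]_(s in `[c, b]) f s.
Proof.
move=> ac cb intf; apply/eqP; rewrite -subr_eq; apply/eqP.
rewrite -(@Rintegral_itv_obnd_cbnd _ c); last first.
  by apply: integrableS intf => //; apply: subset_itv; rewrite bnd_simp.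
rewrite -(@Rintegral_itvB _ _ (BLeft a) (BRight b))//; lra.
Qed.

Lemma integrable_itvS f a b c e : a <= c -> e <= b ->
  mu.-integrable `[a, b] (EFin \o f) -> mu.-integrable `[c, e] (EFin \o f).
Proof.
by move=> ac eb; apply: integrableS => //; apply: subset_itv; rewrite bnd_simp.
Qed.

Lemma integrable_itv_cst a b (r : R) : mu.-integrable `[a, b] (EFin \o cst r).
Proof.
apply: measurable_bounded_integrable => //.
- rewrite /= lebesgue_measure_itv/=; case: ifPn => // _.
  by rewrite -EFinB ltry.
- exact: bounded_cst.
Qed.

Lemma Rintegral_itv_cst a b (r : R) : a <= b ->
  \int[mu]_(s in `[a, b]) r = r * (b - a).
Proof.
move=> ab; rewrite Rintegral_cst//= lebesgue_measure_itv/= lte_fin.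
by case: ltgtP ab => // -> _; rewrite subrr.
Qed.

Lemma Rintegral_itv_le_cst f a b (r : R) : a <= b ->
  mu.-integrable `[a, b] (EFin \o f) ->
  (forall s, s \in `[a, b] -> f s <= r) ->
  \int[mu]_(s in `[a, b]) f s <= r * (b - a).
Proof.
move=> ab intf fr; rewrite -Rintegral_itv_cst//.
by apply: le_Rintegral => //; exact: integrable_itv_cst.
Qed.

Lemma integrable_itvD f g a b : mu.-integrable `[a, b] (EFin \o f) ->
  mu.-integrable `[a, b] (EFin \o g) ->
  mu.-integrable `[a, b] (EFin \o (fun s => f s + g s)).
Proof. by move=> fi gi; exact: (integrableD _ fi gi). Qed.

Lemma integrable_itvZ f a b (r : R) : mu.-integrable `[a, b] (EFin \o f) ->
  mu.-integrable `[a, b] (EFin \o (fun s => r * f s)).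
Proof. by move=> fi; exact: (integrableZl _ r fi). Qed.

Lemma integrable_itvB f g a b : mu.-integrable `[a, b] (EFin \o f) ->
  mu.-integrable `[a, b] (EFin \o g) ->
  mu.-integrable `[a, b] (EFin \o (fun s => f s - g s)).
Proof. by move=> fi gi; exact: (integrableB _ fi gi). Qed.

Lemma integrable_itv_sum n (f : 'I_n -> R -> R) a b :
  (forall i, mu.-integrable `[a, b] (EFin \o f i)) ->
  mu.-integrable `[a, b] (EFin \o (fun s => \sum_i f i s)).
Proof.
move=> fi; have mab := measurable_itv `[a, b].
have := @integrable_sum _ _ _ mu _ mab _ (index_enum 'I_n) xpredT (fun i s => (f i s)%:E).
move=> /(_ (fun i _ => fi i)); apply: eq_integrable => // s _ /=.
by rewrite sumEFin.
Qed.

Lemma Rintegral_itv1 f a : \int[mu]_(s in `[a, a]) f s = 0.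
Proof. by rewrite set_itv1 Rintegral_set1. Qed.

End interval_integral.

(** * Measurability of Caratheodory functions *)

Section within_itv.
Context {R : realType} {V : normedModType R}.
Implicit Types (a b c e : R) (g : R -> V).

Lemma within_itv_continuousP a b g : {within `[a, b], continuous g} <->
  forall s, s \in `[a, b] -> forall eps, 0 < eps -> exists2 eta : R, 0 < eta &
    forall r, r \in `[a, b] -> `|r - s| < eta -> `|g r - g s| <= eps.
Proof.
split.
- move=> /subspace_continuousP + s sab eps eps0 => /(_ s sab).
  move=> /cvgrPdist_le /(_ _ eps0); rewrite near_withinE => -[eta /= eta0 H].
  exists eta => // r rab rs; rewrite distrC; apply: H => //=.
  by rewrite distrC.
- move=> H; apply/subspace_continuousP => s sab.
  apply/cvgrPdist_le => eps eps0; rewrite near_withinE.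
  have [eta eta0 h] := H s sab eps eps0.
  by exists eta => //= r rs rab; rewrite distrC; apply: h => //; rewrite distrC.
Qed.

Lemma within_itv_continuous_sub a b c e g : a <= c -> e <= b ->
  {within `[a, b], continuous g} -> {within `[c, e], continuous g}.
Proof.
by move=> ac eb; apply: continuous_subspaceW; apply: subset_itv; rewrite bnd_simp.
Qed.

Lemma within_itv_continuous_translate a b e g : {within `[a, b], continuous g} ->
  {within `[a - e, b - e], continuous (fun s => g (s + e))}.
Proof.
move=> /within_itv_continuousP H; apply/within_itv_continuousP => s sab eps eps0.
have /H/(_ _ eps0)[eta eta0 h] : s + e \in `[a, b].
  by move: sab; rewrite !in_itv/= => /andP[? ?]; lra.
exists eta => // r rab rs; apply: h; last by rewrite opprD addrACA subrr addr0.
by move: rab; rewrite !in_itv/= => /andP[? ?]; lra.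
Qed.

Lemma within_itv_continuous_glue a c b (g1 g2 : R -> V) : a <= c <= b ->
  g1 c = g2 c ->
  {within `[a, c], continuous g1} -> {within `[c, b], continuous g2} ->
  {within `[a, b], continuous (fun s => if s <= c then g1 s else g2 s)}.
Proof.
move=> /andP[ac cb] g12 c1 c2.
have -> : `[a, b]%classic = `[a, c]%classic `|` `[c, b]%classic.
  apply/seteqP; split => s /=; rewrite !in_itv/=.
    by move=> /andP[as_ sb]; case: (leP s c) => ?; [left|right]; rewrite ?as_//= sb ltW.
  by case=> /andP[? ?]; lra.
apply: withinU_continuous; [exact: itv_closed..| |].
- move: c1 => /within_itv_continuousP H; apply/within_itv_continuousP => s sab.
  move=> eps /(H s sab)[eta eta0 h]; exists eta => // r rab rs.
  have -> : r <= c by move: rab; rewrite in_itv/= => /andP[].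
  have -> : s <= c by move: sab; rewrite in_itv/= => /andP[].
  exact: h.
- have E s : s \in `[c, b] -> (if s <= c then g1 s else g2 s) = g2 s.
    rewrite in_itv/= => /andP[cs _]; case: ifPn => // sc.
    by have -> : s = c by apply/le_anti; rewrite sc cs.
  move: c2 => /within_itv_continuousP H; apply/within_itv_continuousP => s sab.
  move=> eps /(H s sab)[eta eta0 h]; exists eta => // r rab rs.
  by rewrite !E//; exact: h.
Qed.

End within_itv.

Lemma within_itv_continuous_coord (R : realType) n (a b : R) (g : R -> 'cV[R]_n) i :
  {within `[a, b], continuous g} -> {within `[a, b], continuous (fun s => g s i 0)}.
Proof.
move=> /within_itv_continuousP H; apply/within_itv_continuousP => s sab.
move=> eps /(H s sab)[eta eta0 h]; exists eta => // r rab rs.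
apply: le_trans (h r rab rs).
by have := normr_coord_le (g r - g s) i; rewrite !mxE.
Qed.

Lemma measurable_coord_within (R : realType) n (a b : R) (g : R -> 'cV[R]_n) i :
  {within `[a, b], continuous g} -> measurable_fun `[a, b] (fun s => g s i 0).
Proof.
move=> cg; apply: subspace_continuous_measurable_fun => //.
exact: within_itv_continuous_coord.
Qed.

Section caratheodory.
Context {R : realType}.

(** Rounding goes downwards, so that times in [0, T] stay in [0, T], where the hypotheses on the
    cost hold. *)
Definition grid (N : nat) (r : R) : R := (Num.floor (N.+1%:R * r))%:~R / N.+1%:R.

Lemma grid_le N r : grid N r <= r.
Proof. by rewrite ler_pdivrMr// mulrC floor_le. Qed.

Lemma grid_ge0 N r : 0 <= r -> 0 <= grid N r.
Proof. by move=> r0; rewrite divr_ge0// ler0z floor_ge0 mulr_ge0. Qed.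

Lemma grid_dist N r : `|r - grid N r| <= N.+1%:R^-1.
Proof.
rewrite ger0_norm ?subr_ge0 ?grid_le//.
rewrite -(ler_pM2l (ltr0Sn R N)) divff ?pnatr_eq0// mulrBr mulrCA divff ?pnatr_eq0//.
by rewrite mulr1 lerBlDr addrC ltW//; have := floorD1_gt (N.+1%:R * r); rewrite intrD.
Qed.

Lemma measurable_fun_countable_range (U : countType) (D : set R) (z : R -> U)
    (Phi : U -> R) : measurable D ->
  (forall w, measurable (D `&` [set s | z s = w])) ->
  measurable_fun D (Phi \o z).
Proof.
move=> mD mz _ Y mY.
have -> : D `&` (Phi \o z) @^-1` Y =
    \bigcup_w (if Phi w \in Y then D `&` [set s | z s = w] else set0).
  apply/seteqP; split => [s [Ds Ys]|s [w _]].
    by exists (z s) => //; rewrite mem_set.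
  by case: ifPn => // /set_mem wY [Ds /= zs]; split => //=; rewrite zs.
apply: countable_bigcupT_measurable => [|w]; first exact: countableP.
by case: ifPn.
Qed.

Lemma measurable_floor_fiber (D : set R) (f : R -> R) (N : nat) (m : int) :
  measurable D -> measurable_fun D f ->
  measurable (D `&` [set s | Num.floor (N.+1%:R * f s) = m]).
Proof.
move=> mD mf.
have mNf : measurable_fun D (fun s => N.+1%:R * f s).
  by apply: measurable_funM => //; exact: measurable_cst.
have -> : D `&` [set s | Num.floor (N.+1%:R * f s) = m] =
    D `&` (fun s => N.+1%:R * f s) @^-1` `[m%:~R, (m + 1)%:~R[.
  congr (_ `&` _); apply/seteqP; split => s /=; rewrite in_itv/=.
    by move=> <-; exact: floor_itv.
  by move=> /floor_def.
exact: mNf.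
Qed.

(* Rounding all arguments of [F] to multiples of [1 / (N + 1)] gives functions with
   countably many values. *)
Lemma measurable_caratheodory n k (D : set R) (F : R -> 'cV[R]_n -> 'cV[R]_k -> R)
    (x : R -> 'cV[R]_n) (u : R -> 'cV[R]_k) : measurable D ->
  (forall i, measurable_fun D (fun s => x s i 0)) ->
  (forall i, measurable_fun D (fun s => u s i 0)) ->
  (forall s, D s -> F (grid N s) (map_mx (grid N) (x s)) (map_mx (grid N) (u s))
     @[N --> \oo] --> F s (x s) (u s)) ->
  measurable_fun D (fun s => F s (x s) (u s)).
Proof.
move=> mD mx mu cF.
pose h N s := F (grid N s) (map_mx (grid N) (x s)) (map_mx (grid N) (u s)).
apply: (@measurable_fun_cvg _ _ _ D h); last exact: cF.
move=> N.
pose z s : int * ('cV[int]_n * 'cV[int]_k) :=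
  (Num.floor (N.+1%:R * s), (map_mx (fun r => Num.floor (N.+1%:R * r)) (x s),
     map_mx (fun r => Num.floor (N.+1%:R * r)) (u s))).
pose g (m : int) : R := m%:~R / N.+1%:R.
pose Phi (w : int * ('cV[int]_n * 'cV[int]_k)) :=
  F (g w.1) (map_mx g w.2.1) (map_mx g w.2.2).
have -> : h N = Phi \o z.
  apply/funext => s; rewrite /h /Phi /z /=; congr (F _ _ _).
  - by apply/colP => i; rewrite !mxE.
  - by apply/colP => i; rewrite !mxE.
apply: measurable_fun_countable_range => // -[m [a b]].
have -> : D `&` [set s | z s = (m, (a, b))] =
    (D `&` [set s | Num.floor (N.+1%:R * s) = m]) `&`
    ((D `&` \bigcap_(i in [set: 'I_n])
        (D `&` [set s | Num.floor (N.+1%:R * x s i 0) = a i 0])) `&`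
     (D `&` \bigcap_(i in [set: 'I_k])
        (D `&` [set s | Num.floor (N.+1%:R * u s i 0) = b i 0]))).
  apply/seteqP; split => [s [Ds]|s [[Ds zs] [[_ as_] [_ bs]]]].
    move=> [zs as_ bs]; split; first by [].
    split; (split; first by []) => i _; split => //=.
    + by rewrite -as_ mxE.
    + by rewrite -bs mxE.
  split => //; rewrite /z /=; congr (_, (_, _)) => //.
  - by apply/colP => i; rewrite mxE; have [] := as_ i I.
  - by apply/colP => i; rewrite mxE; have [] := bs i I.
apply: measurableI; [|apply: measurableI; apply: measurableI => //].
- by apply: measurable_floor_fiber => //; exact: measurable_id.
- apply: fin_bigcap_measurable => [|i _]; first exact: finite_finset.
  exact: measurable_floor_fiber.
- apply: fin_bigcap_measurable => [|i _]; first exact: finite_finset.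
  exact: measurable_floor_fiber.
Qed.

Lemma cvg_map_grid n (x : 'cV[R]_n) : map_mx (grid N) x @[N --> \oo] --> x.
Proof.
apply/cvgrPdist_le => e e0; near=> N.
apply: normr_cV_le => [|i]; first exact: ltW.
rewrite !mxE (le_trans (grid_dist _ _))//.
near: N; have := @near_infty_natSinv_lt R (PosNum e0).
by apply: filterS => N /= /ltW.
Unshelve. all: by end_near. Qed.

Lemma cvg_grid (r : R) : grid N r @[N --> \oo] --> r.
Proof.
apply/cvgrPdist_le => e e0; near=> N.
rewrite (le_trans (grid_dist _ _))//.
near: N; have := @near_infty_natSinv_lt R (PosNum e0).
by apply: filterS => N /= /ltW.
Unshelve. all: by end_near. Qed.

Lemma measurable_continuous_comp n k (D : set R) (F : 'cV[R]_n * 'cV[R]_k -> R)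
    (x : R -> 'cV[R]_n) (u : R -> 'cV[R]_k) : measurable D ->
  (forall i, measurable_fun D (fun s => x s i 0)) ->
  (forall i, measurable_fun D (fun s => u s i 0)) ->
  continuous F -> measurable_fun D (fun s => F (x s, u s)).
Proof.
move=> mD mx mu cF.
apply: (@measurable_caratheodory _ _ D (fun _ x u => F (x, u))) => // s Ds.
apply: (@continuous_cvg _ _ _ _ _ (fun N => (map_mx (grid N) (x s), map_mx (grid N) (u s))) F).
  exact: cF.
exact: (@cvg_pair _ _ _ _ (nbhs (x s)) (nbhs (u s)) _ _ _ _ _
  (@cvg_map_grid _ (x s)) (@cvg_map_grid _ (u s))).
Qed.

Lemma measurable_normr_cV k (D : set R) (u : R -> 'cV[R]_k) : measurable D ->
  (forall i, measurable_fun D (fun s => u s i 0)) ->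
  measurable_fun D (fun s => `|u s|).
Proof.
move=> mD mu.
apply: (@measurable_continuous_comp 0 k D (fun z => `|z.2|) (fun=> 0)) => //.
move=> z; apply: continuous_comp; first exact: cvg_snd.
exact: norm_continuous.
Qed.

End caratheodory.

(** * Controls and trajectories *)

Section controls.
Context {R : realType} {k : nat}.
Local Notation mu := (@lebesgue_measure R).
Implicit Types (a b c e p : R) (u : R -> 'cV[R]_k).

Lemma measurable_enorm (D : set R) u : measurable D ->
  (forall j, measurable_fun D (fun s => u s j 0)) ->
  measurable_fun D (fun s => enorm (u s)).
Proof.
move=> mD mu_.
have -> : (fun s => enorm (u s)) = (@Num.sqrt R) \o (fun s => \sum_j u s j 0 ^+ 2).
  by [].
apply: measurableT_comp.
  by apply: continuous_measurable_fun; exact: sqrt_continuous.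
by apply: measurable_sum => j; exact: measurable_funX.
Qed.

Lemma le_integrable_itv a b (f h : R -> R) : measurable_fun `[a, b] f ->
  (forall s, s \in `[a, b] -> `|f s| <= h s) ->
  mu.-integrable `[a, b] (EFin \o h) -> mu.-integrable `[a, b] (EFin \o f).
Proof.
move=> mf fh; apply: le_integrable => //; first exact/measurable_EFinP.
move=> s sab; rewrite /= lee_fin (le_trans (fh s sab))//.
exact: ler_norm.
Qed.

(** Replaces Hoelder's inequality on finite measure spaces: a finite p-th moment gives a finite
    first moment. *)
Lemma le1D_powR (x p : R) : 0 <= x -> 1 <= p -> x <= 1 + x `^ p.
Proof.
move=> x0 p1; have [x1|x1] := leP x 1.
  by rewrite (le_trans x1)// lerDl powR_ge0.
by have := ler_powR (ltW x1) p1; rewrite powRr1// => /le_trans; apply; rewrite lerDr ler01.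
Qed.

Lemma Lp_control_integrable p a b u : 1 <= p -> Lp_control p a b u ->
  forall j, mu.-integrable `[a, b] (EFin \o (fun s => u s j 0)).
Proof.
move=> p1 [mu_ foo] j.
have mp : measurable_fun `[a, b] (fun s => enorm (u s) `^ p).
  apply: (measurableT_comp (measurable_powR p)).
  exact: measurable_enorm.
apply: (@le_integrable_itv _ _ _ (fun s => 1 + enorm (u s) `^ p)) => // [s sab|].
  rewrite (le_trans (normr_coord_le _ _))// (le_trans (normr_le_enorm _))//.
  by apply: le1D_powR; rewrite ?enorm_ge0.
apply: integrable_itvD; first exact: integrable_itv_cst.
apply/integrableP; split; first exact/measurable_EFinP.
apply: le_lt_trans foo; apply: ge0_le_integral => //=.
- by do 2 apply: measurableT_comp => //.
- by apply/measurable_EFinP.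
- by move=> s _; rewrite lee_fin ger0_norm ?powR_ge0.
Qed.

(** The form in which square integrability is used below: sup norm and integer power, with
    real-valued integrals. The two norms differ at most by the factor [k.+1]. *)
Lemma Lp_control2P a b u : Lp_control 2 a b u <->
  (forall j, measurable_fun `[a, b] (fun s => u s j 0)) /\
  mu.-integrable `[a, b] (EFin \o (fun s => `|u s| ^+ 2)).
Proof.
split=> -[mu_ foo]; split => //.
  have me : measurable_fun `[a, b] (fun s => enorm (u s) `^ 2).
    apply: (measurableT_comp (measurable_powR 2)).
    exact: measurable_enorm.
  apply/integrableP; split.
    apply/measurable_EFinP; apply: measurable_funX.
    exact: measurable_normr_cV.
  apply: le_lt_trans foo; apply: ge0_le_integral => //=.
  - do 2 apply: measurableT_comp => //; apply: measurable_funX.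
    exact: measurable_normr_cV.
  - by apply/measurable_EFinP.
  - move=> s _; rewrite lee_fin ger0_norm ?sqr_ge0// powR_mulrn ?enorm_ge0//.
    by rewrite lerXn2r ?nnegrE ?enorm_ge0// normr_le_enorm.
have me : measurable_fun `[a, b] (fun s => enorm (u s) `^ 2).
  apply: (measurableT_comp (measurable_powR 2)).
  exact: measurable_enorm.
suff : mu.-integrable `[a, b] (EFin \o (fun s => enorm (u s) `^ 2)).
  move=> /integrableP[_]; apply: le_lt_trans; apply: ge0_le_integral => //=.
  - by move=> s _; rewrite lee_fin powR_ge0.
  - by apply/measurable_EFinP.
  - by do 2 apply: measurableT_comp => //.
  - by move=> s _; rewrite lee_fin ger0_norm ?powR_ge0.
apply: (@le_integrable_itv _ _ _ (fun s => k.+1%:R ^+ 2 * `|u s| ^+ 2)) => //.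
  move=> s sab; rewrite ger0_norm ?powR_ge0// powR_mulrn ?enorm_ge0// -exprMn.
  by rewrite lerXn2r ?nnegrE ?mulr_ge0 ?enorm_ge0// enorm_le_normr.
exact: integrable_itvZ.
Qed.

Lemma Lp_control2_sub a b c e u : a <= c -> e <= b ->
  Lp_control 2 a b u -> Lp_control 2 c e u.
Proof.
move=> ac eb /Lp_control2P[mu_ iu]; apply/Lp_control2P; split=> [j|].
  by apply: measurable_funS (mu_ j) => //; apply: subset_itv; rewrite bnd_simp.
exact: integrable_itvS iu.
Qed.

Lemma Lp_control2_translate a b e u : Lp_control 2 a b u ->
  Lp_control 2 (a - e) (b - e) (fun s => u (s + e)).
Proof.
move=> /Lp_control2P[mu_ iu]; apply/Lp_control2P; split=> [j|].
  exact: (@measurable_fun_translate _ _ _ e _ a b (mu_ j)).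
exact: (@integrable_translate _ e _ a b iu).
Qed.

Lemma measurable_fun_glue a c b (f1 f2 : R -> R) : a <= c <= b ->
  measurable_fun `[a, c] f1 -> measurable_fun `[c, b] f2 ->
  measurable_fun `[a, b] (fun s => if s <= c then f1 s else f2 s).
Proof.
move=> /andP[ac cb] m1 m2.
have -> : `[a, b]%classic = `[a, c]%classic `|` `]c, b]%classic.
  by rewrite -itv_bndbnd_setU// bnd_simp.
apply/measurable_funU => //; split.
- apply: eq_measurable_fun m1 => s /set_mem/=; rewrite in_itv/= => /andP[_ sc].
  by rewrite sc.
- apply: (@eq_measurable_fun _ _ _ _ _ f2).
    move=> s /set_mem/=; rewrite in_itv/= => /andP[cs _].
    by rewrite leNgt cs.
  by apply: measurable_funS m2 => //; apply: subset_itvr; rewrite bnd_simp.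
Qed.

Lemma integrable_glue a c b (f1 f2 : R -> R) : a <= c <= b ->
  mu.-integrable `[a, c] (EFin \o f1) -> mu.-integrable `[c, b] (EFin \o f2) ->
  mu.-integrable `[a, b] (EFin \o (fun s => if s <= c then f1 s else f2 s)).
Proof.
move=> acb i1 i2; case/andP: (acb) => ac cb; apply/integrableP; split.
  apply/measurable_EFinP; apply: measurable_fun_glue => //.
  - by case/integrableP : i1 => /measurable_EFinP.
  - by case/integrableP : i2 => /measurable_EFinP.
have mg : measurable_fun `[a, b] (fun s => if s <= c then f1 s else f2 s).
  apply: measurable_fun_glue => //.
  - by case/integrableP : i1 => /measurable_EFinP.
  - by case/integrableP : i2 => /measurable_EFinP.
have -> : `[a, b]%classic = `[a, c]%classic `|` `]c, b]%classic.
  by rewrite -itv_bndbnd_setU// bnd_simp.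
rewrite ge0_integral_setU//=.
- apply: lte_add_pinfty.
  + case/integrableP : i1 => _; apply: le_lt_trans.
    rewrite le_eqVlt; apply/orP; left; apply/eqP.
    by apply: eq_integral => s /set_mem/=; rewrite in_itv/= => /andP[_ ->].
  + have /integrableP[_] : mu.-integrable `]c, b] (EFin \o f2).
      by apply: integrableS i2 => //; apply: subset_itvr; rewrite bnd_simp.
    apply: le_lt_trans; rewrite le_eqVlt; apply/orP; left; apply/eqP.
    apply: eq_integral => s /set_mem/=; rewrite in_itv/= => /andP[cs _].
    by rewrite leNgt cs.
- rewrite -itv_bndbnd_setU ?bnd_simp//.
  by do 2 apply: measurableT_comp => //.
- apply/disj_setPS => s [/=]; rewrite !in_itv/= => /andP[_ sc] /andP[].
  by rewrite ltNge sc.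
Qed.

Lemma Rintegral_glue a c b (f1 f2 : R -> R) : a <= c <= b ->
  mu.-integrable `[a, c] (EFin \o f1) -> mu.-integrable `[c, b] (EFin \o f2) ->
  \int[mu]_(s in `[a, b]) (if s <= c then f1 s else f2 s) =
  \int[mu]_(s in `[a, c]) f1 s + \int[mu]_(s in `[c, b]) f2 s.
Proof.
move=> acb i1 i2; case/andP: (acb) => ac cb.
rewrite (@Rintegral_itv_split _ _ a c b)//; last exact: integrable_glue.
congr (_ + _).
  by apply: eq_Rintegral => s /set_mem/=; rewrite in_itv/= => /andP[_ ->].
have i2' : mu.-integrable `]c, b] (EFin \o f2).
  by apply: integrableS i2 => //; apply: subset_itvr; rewrite bnd_simp.
rewrite -!(@Rintegral_itv_obnd_cbnd _ c)//; last first.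
  apply: eq_integrable i2' => // s /set_mem/=; rewrite in_itv/= => /andP[cs _].
  by rewrite leNgt cs.
apply: eq_Rintegral => s /set_mem/=; rewrite in_itv/= => /andP[cs _].
by rewrite leNgt cs.
Qed.

Lemma Lp_control2_glue a c b u1 u2 : a <= c <= b ->
  Lp_control 2 a c u1 -> Lp_control 2 c b u2 ->
  Lp_control 2 a b (fun s => if s <= c then u1 s else u2 s).
Proof.
move=> acb /Lp_control2P[m1 i1] /Lp_control2P[m2 i2]; apply/Lp_control2P; split.
  move=> j; have := measurable_fun_glue acb (m1 j) (m2 j).
  by apply: eq_measurable_fun => s _; case: ifP.
have := integrable_glue acb i1 i2.
by apply: eq_integrable => // s _ /=; case: ifP.
Qed.

Lemma Lp_control2_0 a b : Lp_control 2 a b (fun=> 0 : 'cV[R]_k).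
Proof.
apply/Lp_control2P; split=> [j|]; first exact: measurable_cst.
have -> : (fun s : R => `|0 : 'cV[R]_k| ^+ 2) = cst 0.
  by apply/funext => s; rewrite normr0 expr0n.
exact: integrable_itv_cst.
Qed.

End controls.

Section trajectories.
Context {R : realType} {d k : nat}.
Variables (A : 'M[R]_d) (B : 'M[R]_(d, k)).
Local Notation mu := (@lebesgue_measure R).
Local Notation traj := (trajectory A B).
Implicit Types (a b c e : R) (u : R -> 'cV[R]_k) (g q : R -> 'cV[R]_d).

Definition integrable_control a b u :=
  forall j, mu.-integrable `[a, b] (EFin \o (fun s => u s j 0)).

Lemma Lp_control2_integrable a b u : Lp_control 2 a b u -> integrable_control a b u.
Proof. by apply: Lp_control_integrable; rewrite ler1n. Qed.

Lemma integrable_within_continuous a b (f : R -> R) :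
  {within `[a, b], continuous f} -> mu.-integrable `[a, b] (EFin \o f).
Proof. by move=> cf; apply: continuous_compact_integrable => //; exact: segment_compact. Qed.

Lemma integrable_velocity a b u g i : {within `[a, b], continuous g} ->
  integrable_control a b u ->
  mu.-integrable `[a, b] (EFin \o (fun s => (A *m g s + B *m u s) i 0)).
Proof.
move=> cg iu.
suff : mu.-integrable `[a, b] (EFin \o (fun s => \sum_j A i j * g s j 0 +
    \sum_j B i j * u s j 0)).
  by apply: eq_integrable => // s _ /=; rewrite !mxE.
apply: integrable_itvD; apply: integrable_itv_sum => j; apply: integrable_itvZ.
  exact/integrable_within_continuous/within_itv_continuous_coord.
exact: iu.
Qed.

Lemma trajectory_start a b y u g : a <= b -> traj a b y u g -> g a = y.
Proof.
move=> ab [_ /(_ a)]; rewrite in_itv/= lexx ab => -> //.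
by apply/colP => i; rewrite !mxE Rintegral_itv1 addr0.
Qed.

Lemma trajectory_restrict a b c e y u g : a <= c -> c <= e -> e <= b ->
  integrable_control a b u -> traj a b y u g -> traj c e (g c) u g.
Proof.
move=> ac ce eb iu [cg gE]; split; first exact: within_itv_continuous_sub cg.
move=> s; rewrite in_itv/= => /andP[cs se].
rewrite !gE ?in_itv/=; [|lra..].
rewrite -addrA; congr (_ + _); apply/colP => i; rewrite ![in RHS]mxE mxE.
rewrite (@Rintegral_itv_split _ _ a c s)//.
have := @integrable_velocity a b u g i cg iu.
by apply: integrable_itvS => //; lra.
Qed.

(** The coefficients [A] and [B] do not depend on time, so a change of variable in the integral
    equation suffices. *)
Lemma trajectory_translate a b e y u g :
  integrable_control a b u -> traj a b y u g ->
  traj (a - e) (b - e) y (fun s => u (s + e)) (fun s => g (s + e)).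
Proof.
move=> iu [cg gE]; split; first exact: within_itv_continuous_translate.
move=> s sab; rewrite gE; last by move: sab; rewrite !in_itv/=; lra.
congr (_ + _); apply/colP => i; rewrite !mxE.
rewrite -(@Rintegral_translate _ e _ a (s + e)); last first.
  have /integrableP[/measurable_EFinP + _] := @integrable_velocity a b u g i cg iu.
  apply: measurable_funS => //; apply: subset_itvl; rewrite bnd_simp.
  by move: sab; rewrite !in_itv/=; lra.
by rewrite addrK.
Qed.

Lemma trajectory_glue a c b y u1 u2 g1 g2 : a <= c <= b ->
  integrable_control a c u1 -> integrable_control c b u2 ->
  traj a c y u1 g1 -> traj c b (g1 c) u2 g2 ->
  traj a b y (fun s => if s <= c then u1 s else u2 s)
             (fun s => if s <= c then g1 s else g2 s).
Proof.
move=> acb i1 i2 T1 T2; case/andP: (acb) => ac cb.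
have g12 : g1 c = g2 c by rewrite (trajectory_start cb T2).
have [c1 E1] := T1; have [c2 E2] := T2.
split; first exact: within_itv_continuous_glue.
move=> s; rewrite in_itv/= => /andP[as_ sb]; case: ifPn => sc.
  rewrite E1; last by rewrite in_itv/= as_.
  congr (_ + _); apply/colP => i; rewrite !mxE.
  apply: eq_Rintegral => r /set_mem/=; rewrite in_itv/= => /andP[_ rs].
  by rewrite (le_trans rs sc).
rewrite -ltNge in sc.
have scb : s \in `[c, b] by rewrite in_itv/= sb (ltW sc).
have cac : c \in `[a, c] by rewrite in_itv/= ac lexx.
rewrite (E2 s scb) (E1 c cac).
rewrite -addrA; congr (_ + _); apply/colP => i; rewrite [in LHS]mxE [in RHS]mxE.
rewrite [X in X + _ = _]mxE [X in _ + X = _]mxE.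
rewrite -(@Rintegral_glue _ a c s) ?ac ?(ltW sc)//.
- by apply: eq_Rintegral => r _; case: ifP.
- exact: integrable_velocity.
- by apply: integrable_itvS (integrable_velocity i c2 i2).
Qed.

(** Superposition: adding a homogeneous solution moves the starting point and keeps the control. All
    comparison trajectories below arise this way. *)
Lemma trajectory_linear a b y z u (l : R) g q :
  integrable_control a b u ->
  traj a b y u g -> traj a b z (fun=> 0) q ->
  traj a b (y + l *: z) u (fun s => g s + l *: q s).
Proof.
move=> iu [cg gE] [cq qE]; split.
  move=> s; apply: cvgD; first exact: cg.
  by apply: cvgZr; exact: cq.
move=> s sab; rewrite gE// qE// scalerDr addrACA; congr (_ + _).
apply/colP => i; rewrite ![in LHS]mxE [RHS]mxE.
have i0 : integrable_control a b (fun=> 0 : 'cV[R]_k).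
  by move=> j; apply: eq_integrable (integrable_itv_cst a b 0) => // r _; rewrite /= mxE.
have sb : s <= b by move: sab; rewrite in_itv/= => /andP[].
have ig : mu.-integrable `[a, s] (EFin \o (fun s => (A *m g s + B *m u s) i 0)).
  by apply: integrable_itvS (integrable_velocity i cg iu).
have iq : mu.-integrable `[a, s] (EFin \o (fun s => (A *m q s + B *m (fun=> 0) s) i 0)).
  by apply: integrable_itvS (integrable_velocity i cq i0).
rewrite -RintegralZl// -RintegralD//; last exact: integrable_itvZ.
apply: eq_Rintegral => r _ /=.
by rewrite mulmx0 addr0 mulmxDr -scalemxAr !mxE; ring.
Qed.

End trajectories.

(** * Semiconcavity for a time-dependent control problem *)

Lemma midpoint_addl (R : realType) d (x y : 'cV[R]_d) :
  2^-1 *: (x + y) + 2^-1 *: (x - y) = x.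
Proof. by apply/colP => i; rewrite !mxE; lra. Qed.

Lemma midpoint_subl (R : realType) d (x y : 'cV[R]_d) :
  2^-1 *: (x + y) - 2^-1 *: (x - y) = y.
Proof. by apply/colP => i; rewrite !mxE; lra. Qed.

(** Here [y] is the end point of the near-optimal curve, [pz] and [ph] are [z] and [h] transported
    over time e, and [z] is the displacement y - ph - x after the first run. The midpoint of the two
    end points misses [y] only by the drifts pz - z and ph - h, which are O(e (|z| + |h|)). *)
Lemma midpoint_defect (R : realType) d (x y h z pz ph : 'cV[R]_d) :
  x - y = - z - ph ->
  2^-1 *: (x + h + (y + pz)) - y = 2^-1 *: ((pz - z) - (ph - h)).
Proof.
move=> xy; apply/colP => i; have := congr1 (fun v : 'cV[R]_d => v i 0) xy.
by rewrite !mxE; lra.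
Qed.

(** Same notation as in [midpoint_defect]; this half difference is of order |z| + |h|, and its
    square is the price of semiconcavity in space. *)
Lemma half_difference (R : realType) d (x y h z pz ph : 'cV[R]_d) :
  x - y = - z - ph ->
  2^-1 *: (x + h - (y + pz)) = 2^-1 *: (- (z + pz) - (ph - h)).
Proof.
move=> xy; apply/colP => i; have := congr1 (fun v : 'cV[R]_d => v i 0) xy.
by rewrite !mxE; lra.
Qed.

(** The arithmetic that ends [short_time_semiconcave]. [W1], [W2], [W3] are the values at (t - e, x
    - h), at time t after the first run, and at (t, x); [Wp], [Wm], [Wmid], [W0] are values at time
    t + e: at x + h, after the second run, at their midpoint, and at the end point of the
    near-optimal curve. [I1], [I2], [I0] are the running costs of the two runs and of that curve
    over [t, t + e], and [J] is its total cost. *)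
Lemma combine_bounds (R : realType) (W1 W2 W3 Wp Wm Wmid W0 I1 I2 I0 J : R)
    (c e h z K S lip q M m n : R) :
  W1 <= I1 + W2 -> W2 <= I2 + Wm ->
  I1 <= I0 + (c * S * e + c * (M * h) * (K * e)) ->
  I2 <= I0 + c * (M * z) * (K * e) ->
  Wp + Wm <= 2 * Wmid + m -> Wmid - W0 <= n ->
  n <= lip * (M * e * (z + h) / 2) -> m <= q ->
  I0 + W0 <= J -> J <= W3 + e ^+ 2 ->
  Wp + W1 - 2 * W3 <= c * (e * S) + c * M * h * (K * e) + c * M * z * (K * e) +
    2 * e ^+ 2 + lip * (M * e * (z + h)) + q.
Proof. lra. Qed.

Lemma time_bounds (R : realType) (T t e s : R) : 0 < e -> 0 <= t - e ->
  t + e <= T -> t <= s -> s <= t + e ->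
  (0 <= s <= T) /\ (0 <= s - e <= T) /\ (0 <= s - t <= T).
Proof. by move=> *; do ![split]; lra. Qed.

Lemma chain_bound (R : realType) (f1 f2 f3 a b c m n : R) :
  f1 - f2 <= a -> f2 - f3 <= b -> b <= c * m * n -> f1 <= f3 + (a + c * n * m).
Proof. lra. Qed.

(* For the mean field game, [F s x u] is [L x u (flow eta s)], [G] is the terminal
   cost for [flow eta T], and [p z s] is [exp(s A) z]. *)
Section control_problem.
Context {R : realType} {d k : nat}.
Variables (A : 'M[R]_d) (B : 'M[R]_(d, k)) (T : R).
Variables (F : R -> 'cV[R]_d -> 'cV[R]_k -> R) (G : 'cV[R]_d -> R).
Variables (a0 c M : R) (p : 'cV[R]_d -> R -> 'cV[R]_d).
Local Notation mu := (@lebesgue_measure R).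
Local Notation traj := (trajectory A B).
Local Notation bA := (mx_bound A).
Local Notation bB := (mx_bound B).

Hypothesis T_ge0 : 0 <= T.
Hypothesis a0_gt0 : 0 < a0.
Hypothesis c_ge0 : 0 <= c.
Hypothesis M_ge0 : 0 <= M.
Hypothesis F_continuous : forall s, 0 <= s <= T ->
  continuous (fun z : 'cV[R]_d * 'cV[R]_k => F s z.1 z.2).
(** The square root reflects the Hoelder exponent of the flow of measures ([flow_d1]); integrated
    over a time e it produces the power 3/2. *)
Hypothesis F_time : forall s r x u, 0 <= s <= T -> 0 <= r <= T ->
  `|F s x u - F r x u| <= c * Num.sqrt `|s - r|.
Hypothesis F_coercive : forall s x u, 0 <= s <= T ->
  a0 * `|u| ^+ 2 - c <= F s x u.
Hypothesis F_growth : forall s x u, 0 <= s <= T ->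
  F s x u <= c * (1 + `|u| ^+ 2).
(** The constant grows quadratically in [u] because it is derived from the quadratic bounds on L;
    hence the need for energy estimates. *)
Hypothesis F_lipschitz : forall s x y u, 0 <= s <= T ->
  F s x u - F s y u <= c * (1 + `|u| ^+ 2) * `|x - y|.
Hypothesis F_semiconcave : forall s x z u, 0 <= s <= T ->
  F s (x + z) u + F s (x - z) u - 2 * F s x u <= c * `|z| ^+ 2.
Hypothesis G_bounded : forall x, `|G x| <= c.
Hypothesis G_lipschitz : forall x y, G x - G y <= c * `|x - y|.
Hypothesis G_semiconcave : forall x z,
  G (x + z) + G (x - z) - 2 * G x <= c * `|z| ^+ 2.
Hypothesis p_traj : forall z, traj 0 T z (fun=> 0) (p z).
Hypothesis p_bound : forall z s, 0 <= s <= T -> `|p z s| <= M * `|z|.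
Hypothesis p_drift : forall z s, 0 <= s <= T -> `|p z s - z| <= M * s * `|z|.

Definition running (u : R -> 'cV[R]_k) (g : R -> 'cV[R]_d) (s : R) : R :=
  F s (g s) (u s).

Definition total_cost (a : R) u g : R :=
  \int[mu]_(s in `[a, T]) running u g s + G (g T).

Definition admissible (a : R) y u g : Prop :=
  Lp_control 2 a T u /\ traj a T y u g.

Definition optimal_value (a : R) (y : 'cV[R]_d) : R :=
  inf [set v | exists u g, [/\ Lp_control 2 a T u, traj a T y u g &
                               v = total_cost a u g]].
Local Notation W := optimal_value.

Implicit Types (a b e s t : R) (x y z : 'cV[R]_d) (u : R -> 'cV[R]_k)
  (g q : R -> 'cV[R]_d).

Lemma running_measurable a b u g : 0 <= a -> b <= T -> Lp_control 2 a b u ->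
  {within `[a, b], continuous g} -> measurable_fun `[a, b] (running u g).
Proof.
move=> ge0a bT /Lp_control2P[mu_ _] cg.
apply: (@measurable_caratheodory _ _ _ _ F g u) => //.
  by move=> i; exact: measurable_coord_within.
move=> s; rewrite /= in_itv/= => /andP[as_ sb].
have s0 : 0 <= s <= T by lra.
have gridT N : 0 <= grid N s <= T.
  by rewrite grid_ge0 ?(le_trans (grid_le _ _))//; lra.
pose gg N := map_mx (grid N) (g s); pose uu N := map_mx (grid N) (u s).
have h1 : F s (gg N) (uu N) @[N --> \oo] --> F s (g s) (u s).
  have h0 : (gg N, uu N) @[N --> \oo] --> (g s, u s).
    exact: (@cvg_pair _ _ _ _ (nbhs (g s)) (nbhs (u s)) _ _ _ _ _
      (@cvg_map_grid _ _ (g s)) (@cvg_map_grid _ _ (u s))).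
  move=> P nP; have H := @F_continuous s s0 (g s, u s) P nP.
  exact: (h0 _ H).
(* [F_time] is uniform in state and control, so rounding the time is harmless even though the other
   arguments vary with [N]. *)
have h2 : F (grid N s) (gg N) (uu N) - F s (gg N) (uu N) @[N --> \oo] --> (0 : R).
  apply: norm_cvg0.
  have h3 : c * Num.sqrt `|grid N s - s| @[N --> \oo] --> (0 : R).
    rewrite -[X in _ --> X](mulr0 c); apply: cvgMr.
    rewrite -sqrtr0; apply: (@continuous_cvg _ _ _ _ _ _ Num.sqrt).
      exact: sqrt_continuous.
    rewrite -[X in _ --> X](normr0 R^o) -(subrr s); apply: cvg_norm.
    by apply: cvgB; [exact: cvg_grid|exact: cvg_cst].
  apply: squeeze_cvgr h3; last exact: cvg_cst.
  by apply: nearW => N; rewrite normr_ge0 F_time.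
have -> : (fun N => F (grid N s) (gg N) (uu N)) =
    (fun N => (F (grid N s) (gg N) (uu N) - F s (gg N) (uu N)) + F s (gg N) (uu N)).
  by apply/funext => N; rewrite subrK.
rewrite -[X in _ --> X]add0r; exact: cvgD h2 h1.
Qed.

Lemma integrable_energy a b u : Lp_control 2 a b u ->
  mu.-integrable `[a, b] (EFin \o (fun s => 1 + `|u s| ^+ 2)).
Proof.
by move=> /Lp_control2P[_ iu]; apply: integrable_itvD => //; exact: integrable_itv_cst.
Qed.

Lemma running_abs_le s x v : 0 <= s <= T -> `|F s x v| <= c * (1 + `|v| ^+ 2).
Proof.
move=> sT; rewrite ler_norml F_growth// andbT.
apply: le_trans (F_coercive x v sT).
have : 0 <= c * `|v| ^+ 2 by rewrite mulr_ge0// sqr_ge0.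
have : 0 <= a0 * `|v| ^+ 2 by rewrite mulr_ge0 ?(ltW a0_gt0) ?sqr_ge0.
lra.
Qed.

Lemma running_integrable a b u g : 0 <= a -> b <= T -> Lp_control 2 a b u ->
  {within `[a, b], continuous g} -> mu.-integrable `[a, b] (EFin \o running u g).
Proof.
move=> ge0a bT Lu cg.
apply: (@le_integrable_itv _ _ _ _ (fun s => c * (1 + `|u s| ^+ 2))).
- exact: running_measurable.
- by move=> s; rewrite in_itv/= => /andP[? ?]; apply: running_abs_le; lra.
- exact/integrable_itvZ/integrable_energy.
Qed.

Lemma total_cost_ge a y u g : 0 <= a <= T -> admissible a y u g ->
  - (c * (T + 1)) <= total_cost a u g.
Proof.
move=> /andP[ge0a aT] [Lu [cg _]].
have h : - c * (T - a) <= \int[mu]_(s in `[a, T]) running u g s.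
  rewrite -Rintegral_itv_cst//; apply: le_Rintegral => //.
  - exact: integrable_itv_cst.
  - exact: running_integrable.
  - move=> s; rewrite /= in_itv/= => /andP[? ?].
    apply: le_trans (F_coercive _ _ _); last by lra.
    by rewrite lerDr mulr_ge0 ?(ltW a0_gt0) ?sqr_ge0.
have := G_bounded (g T); rewrite ler_norml => /andP[h2 _].
have : 0 <= c * a by rewrite mulr_ge0.
rewrite /total_cost; lra.
Qed.

Lemma p_traj_from a b z : b - a <= T ->
  traj a b z (fun=> 0) (fun s => p z (s - a)).
Proof.
move=> baT.
have i0 : integrable_control 0 T (fun=> 0 : 'cV[R]_k).
  exact/Lp_control2_integrable/Lp_control2_0.
have [ab|ba] := leP a b; last first.
  split => [|s]; last by rewrite in_itv/= => /andP[? ?]; exfalso; lra.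
  by apply/within_itv_continuousP => s; rewrite in_itv/= => /andP[? ?]; exfalso; lra.
have := trajectory_translate (- a) i0 (p_traj z).
have i1 : integrable_control (0 - - a) (T - - a) (fun=> 0 : 'cV[R]_k).
  exact/Lp_control2_integrable/Lp_control2_0.
have pz : p z (a - a) = z by rewrite subrr (trajectory_start T_ge0 (p_traj z)).
rewrite -[X in traj a b X](pz).
apply: trajectory_restrict => //; lra.
Qed.

Lemma admissible0 a y : 0 <= a <= T ->
  admissible a y (fun=> 0) (fun s => p y (s - a)).
Proof. by move=> ?; split; [exact: Lp_control2_0|apply: p_traj_from; lra]. Qed.

Lemma optimal_value_le a y u g : 0 <= a <= T -> admissible a y u g ->
  W a y <= total_cost a u g.
Proof.
move=> aT [Lu tg]; apply: ge_inf; last by exists u, g.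
exists (- (c * (T + 1))) => _ [u' [g' [Lu' tg' ->]]].
by apply: (@total_cost_ge _ y).
Qed.

Lemma optimal_value_approx a y eps : 0 <= a <= T -> 0 < eps ->
  exists u g, admissible a y u g /\ total_cost a u g <= W a y + eps.
Proof.
move=> aT eps0.
have [|_ [u [g [Lu tg ->]]] h] := @inf_adherent _ [set v | exists u g,
    [/\ Lp_control 2 a T u, traj a T y u g & v = total_cost a u g]] _ eps0.
  split; last first.
    exists (- (c * (T + 1))) => _ [u' [g' [Lu' tg' ->]]].
    by apply: (@total_cost_ge _ y).
  have [L0 t0] := admissible0 y aT.
  by exists (total_cost a (fun=> 0) (fun s => p y (s - a))), (fun=> 0), (fun s => p y (s - a)).
by exists u, g; split => //; exact: ltW.
Qed.

(** Continue [g] after time [b] by an eps-optimal trajectory from [g b]. *)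
Lemma dynamic_programming_le a b y u g : 0 <= a -> a <= b -> b <= T ->
  Lp_control 2 a b u -> traj a b y u g ->
  W a y <= \int[mu]_(s in `[a, b]) running u g s + W b (g b).
Proof.
move=> ge0a ab bT Lu tg; apply/ler_addgt0Pr => eps eps0.
have b0T : 0 <= b <= T by lra.
have [v [q [[Lv tq] h]]] := optimal_value_approx (g b) b0T eps0.
suff h1 : W a y <= \int[mu]_(s in `[a, b]) running u g s + total_cost b v q.
  by rewrite -addrA (le_trans h1)// lerD2l.
have abT : a <= b <= T by lra.
pose w s := if s <= b then u s else v s; pose r s := if s <= b then g s else q s.
have adm : admissible a y w r.
  split; first exact: Lp_control2_glue.
  apply: trajectory_glue => //; exact: Lp_control2_integrable.
apply: le_trans (optimal_value_le _ adm) _; first by lra.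
have [cg _] := tg; have [cq _] := tq.
rewrite /total_cost addrA; apply: lerD.
  rewrite -(@Rintegral_glue _ a b T)//.
  - rewrite le_eqVlt; apply/orP; left; apply/eqP; apply: eq_Rintegral => s _.
    by rewrite /running /w /r; case: ifP.
  - exact: running_integrable.
  - by apply: running_integrable => //; lra.
(* If [b = T], the glued curve takes its final value from [g] and not from [q]; they agree since [q]
   starts at [g b]. *)
rewrite /r; case: ifPn => // Tb.
have -> : T = b by apply/le_anti; rewrite Tb bT.
by rewrite (trajectory_start bT tq).
Qed.

Lemma dynamic_programming_ge a b y u g : 0 <= a -> a <= b -> b <= T ->
  admissible a y u g ->
  \int[mu]_(s in `[a, b]) running u g s + W b (g b) <= total_cost a u g.
Proof.
move=> ge0a ab bT [Lu tg]; have [cg _] := tg.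
rewrite /total_cost (@Rintegral_itv_split _ _ a b T)//; last exact: running_integrable.
rewrite -addrA lerD2l; apply: (@optimal_value_le _ (g b)); first by lra.
split; first exact: Lp_control2_sub Lu.
apply: trajectory_restrict tg => //; exact: Lp_control2_integrable.
Qed.

Definition value_bound : R := c * (T + 1).

Lemma value_bound_ge0 : 0 <= value_bound.
Proof. by rewrite mulr_ge0// addr_ge0. Qed.

Lemma optimal_value_bounded a y : 0 <= a <= T -> `|W a y| <= value_bound.
Proof.
move=> aT; rewrite ler_norml; apply/andP; split.
  apply: lb_le_inf.
    have [L0 t0] := admissible0 y aT.
    by exists (total_cost a (fun=> 0) (fun s => p y (s - a))), (fun=> 0), (fun s => p y (s - a)).
  by move=> _ [u' [g' [Lu' tg' ->]]]; apply: (@total_cost_ge _ y).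
have adm := admissible0 y aT; case: (adm) => L0 [c0 _].
apply: le_trans (optimal_value_le aT adm) _.
rewrite /total_cost /value_bound.
have h : \int[mu]_(s in `[a, T]) running (fun=> 0) (fun s => p y (s - a)) s <= c * (T - a).
  apply: Rintegral_itv_le_cst; [lra| |].
    by apply: running_integrable => //; lra.
  move=> s; rewrite in_itv/= => /andP[? ?].
  apply: le_trans (F_growth _ _ _) _; first by lra.
  by rewrite normr0 expr0n/= addr0 mulr1.
have := G_bounded (p y (T - a)); rewrite ler_norml => /andP[_ h2].
have : 0 <= c * a by rewrite mulr_ge0//; case/andP : aT.
lra.
Qed.

Lemma coercive_integral a b u g : 0 <= a -> a <= b -> b <= T ->
  Lp_control 2 a b u -> {within `[a, b], continuous g} ->
  a0 * \int[mu]_(s in `[a, b]) (`|u s| ^+ 2) - c * (b - a) <=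
  \int[mu]_(s in `[a, b]) running u g s.
Proof.
move=> ge0a ab bT Lu cg; have /Lp_control2P[_ iu] := Lu.
rewrite -RintegralZl// -Rintegral_itv_cst//.
rewrite -RintegralB//; [|exact: integrable_itvZ|exact: integrable_itv_cst].
apply: le_Rintegral => //.
- by apply: integrable_itvB; [exact: integrable_itvZ|exact: integrable_itv_cst].
- exact: running_integrable.
- by move=> s; rewrite /= in_itv/= => /andP[? ?]; apply: F_coercive; lra.
Qed.

(** For a control within 1 of the infimum, [a0] times the energy is at most the cost,
    [value_bound + 1], plus the negative parts c (T - a) and c left by coercivity and by the
    terminal cost. *)
Definition energy_bound : R := (2 * value_bound + 1 ) / a0.

Lemma energy_bound_ge0 : 0 <= energy_bound.
Proof. by rewrite divr_ge0 ?(ltW a0_gt0)// addr_ge0// mulr_ge0// value_bound_ge0. Qed.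

Lemma energy_le a y u g : 0 <= a <= T -> admissible a y u g ->
  total_cost a u g <= W a y + 1 ->
  \int[mu]_(s in `[a, T]) (`|u s| ^+ 2) <= energy_bound.
Proof.
move=> aT [Lu [cg gE]] h.
have := @coercive_integral a T u g.
have /andP[ge0a leaT] := aT.
move=> /(_ ge0a leaT (lexx _) Lu cg) h1.
have := optimal_value_bounded y aT; rewrite ler_norml => /andP[_ h2].
have := G_bounded (g T); rewrite ler_norml => /andP[h3 _].
rewrite /energy_bound ler_pdivlMr// mulrC.
rewrite /total_cost in h.
have : 0 <= c * a by rewrite mulr_ge0.
rewrite /value_bound in h2 *; lra.
Qed.

(** Integrates a pointwise comparison of running costs: [l] is the price of a shift in time, [m]
    that of a shift in space, which is weighted by 1 + |u|^2. *)
Lemma Rintegral_running_diff_le a b u (f h : R -> R) (l m : R) : a <= b ->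
  Lp_control 2 a b u ->
  mu.-integrable `[a, b] (EFin \o f) -> mu.-integrable `[a, b] (EFin \o h) ->
  (forall s, s \in `[a, b] -> f s <= h s + (l + m * (1 + `|u s| ^+ 2))) ->
  \int[mu]_(s in `[a, b]) f s <= \int[mu]_(s in `[a, b]) h s +
    (l * (b - a) + m * \int[mu]_(s in `[a, b]) (1 + `|u s| ^+ 2)).
Proof.
move=> ab Lu fi hi H; have ie := integrable_energy Lu.
have il := integrable_itv_cst a b l.
rewrite -Rintegral_itv_cst// -RintegralZl//.
rewrite -RintegralD//; last exact: integrable_itvZ.
rewrite -RintegralD//; last by apply: integrable_itvD => //; exact: integrable_itvZ.
apply: le_Rintegral => //.
by apply: integrable_itvD => //; apply: integrable_itvD => //; exact: integrable_itvZ.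
Qed.

Lemma Rintegral_energy a b u : a <= b -> Lp_control 2 a b u ->
  \int[mu]_(s in `[a, b]) (1 + `|u s| ^+ 2) =
  (b - a) + \int[mu]_(s in `[a, b]) (`|u s| ^+ 2).
Proof.
move=> ab /Lp_control2P[_ iu]; rewrite RintegralD//; last exact: integrable_itv_cst.
by rewrite Rintegral_itv_cst// mul1r.
Qed.

Lemma admissible_shift a y z u g (l : R) : 0 <= a <= T -> admissible a y u g ->
  admissible a (y + l *: z) u (fun s => g s + l *: p z (s - a)).
Proof.
move=> aT [Lu tg]; split => //; apply: trajectory_linear => //.
  exact: Lp_control2_integrable.
by apply: p_traj_from; lra.
Qed.

Definition value_lip : R := c * M * (T + energy_bound + 1).

Lemma value_lip_ge0 : 0 <= value_lip.
Proof. by rewrite !mulr_ge0// !addr_ge0// energy_bound_ge0. Qed.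

(** A near-optimal trajectory from [x] is shifted by the homogeneous solution from [y - x]. The
    running cost changes by at most c M |y - x| times the integral of 1 + |u|^2, which [energy_le]
    bounds. *)
Lemma optimal_value_lipschitz a x y : 0 <= a <= T ->
  W a y - W a x <= value_lip * `|y - x|.
Proof.
move=> aT; rewrite lerBlDr; apply/ler_addgt0Pr => eps0 eps00.
(* The bound by 1 makes [energy_le] applicable, uniformly in [eps0]. *)
pose eps := Num.min eps0 1.
have eps_gt0 : 0 < eps by rewrite lt_min eps00 ltr01.
have [u [g [adm h]]] := optimal_value_approx x aT eps_gt0.
have h1 : total_cost a u g <= W a x + 1.
  by rewrite (le_trans h)// lerD2l ge_min lexx orbT.
have h0 : total_cost a u g <= W a x + eps0.
  by rewrite (le_trans h)// lerD2l ge_min lexx.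
have E := energy_le aT adm h1.
have adm' := admissible_shift (y - x) 1 aT adm.
rewrite scale1r addrC subrK in adm'.
apply: le_trans (optimal_value_le aT adm') _.
suff : total_cost a u (fun s => g s + 1 *: p (y - x) (s - a)) <=
  total_cost a u g + value_lip * `|y - x| by lra.
have /andP[ge0a leaT] := aT.
have [Lu [cg _]] := adm; have [_ [cg' _]] := adm'.
set g' := fun s => g s + _ in cg' *.
have i1 := running_integrable ge0a (lexx _) Lu cg.
have i2 := running_integrable ge0a (lexx _) Lu cg'.
set n := `|y - x|; have n0 : 0 <= n := normr_ge0 _.
have dp s : a <= s <= T -> `|1 *: p (y - x) (s - a)| <= M * n.
  by move=> ?; rewrite scale1r; apply: p_bound; lra.
have := @Rintegral_running_diff_le a T u _ _ 0 (c * (M * n)) leaT Lu i2 i1.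
rewrite mul0r add0r Rintegral_energy// => H.
have {}H : \int[mu]_(s in `[a, T]) running u g' s <= \int[mu]_(s in `[a, T]) running u g s +
   c * (M * n) * (T - a + \int[mu]_(s in `[a, T]) (`|u s| ^+ 2)).
  apply: H => s; rewrite in_itv/= => sT.
  rewrite add0r -lerBlDl.
  apply: le_trans (F_lipschitz _ _ _ _) _; first by lra.
  rewrite /g' addrAC subrr add0r mulrAC ler_wpM2r ?addr_ge0 ?sqr_ge0//.
  by rewrite ler_wpM2l// dp.
have G1 : G (g' T) <= G (g T) + c * (M * n).
  rewrite -lerBlDl (le_trans (G_lipschitz _ _))// /g' addrAC subrr add0r.
  by rewrite ler_wpM2l// dp//; lra.
have : c * (M * n) * (T - a + \int[mu]_(s in `[a, T]) (`|u s| ^+ 2)) <=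
  c * (M * n) * (T + energy_bound).
  by apply: ler_wpM2l; [rewrite !mulr_ge0//|lra].
rewrite /total_cost /value_lip; lra.
Qed.

Definition value_sc : R := c * M ^+ 2 * (T + 1).

Lemma value_sc_ge0 : 0 <= value_sc.
Proof. by rewrite !mulr_ge0 ?sqr_ge0// addr_ge0. Qed.

Lemma optimal_value_semiconcave a y z : 0 <= a <= T ->
  W a (y + z) + W a (y - z) <= 2 * W a y + value_sc * `|z| ^+ 2.
Proof.
move=> aT; apply/ler_addgt0Pr => eps eps0.
have eps2 : 0 < eps / 2 by lra.
have [u [g [adm h]]] := optimal_value_approx y aT eps2.
have adm1 := admissible_shift z 1 aT adm.
have adm2 := admissible_shift z (-1) aT adm.
have W1 := optimal_value_le aT adm1.
have W2 := optimal_value_le aT adm2.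
rewrite scale1r in W1; rewrite scaleN1r in W2.
apply: le_trans (lerD W1 W2) _.
have /andP[ge0a leaT] := aT.
have [Lu [cg _]] := adm; have [_ [cg1 _]] := adm1; have [_ [cg2 _]] := adm2.
set g1 := fun s => g s + 1 *: _ in cg1 *.
set g2 := fun s => g s + -1 *: _ in cg2 *.
have i0 := running_integrable ge0a (lexx _) Lu cg.
have i1 := running_integrable ge0a (lexx _) Lu cg1.
have i2 := running_integrable ge0a (lexx _) Lu cg2.
set n := `|z|; have n0 : 0 <= n := normr_ge0 _.
have dp s : a <= s <= T -> `|p z (s - a)| ^+ 2 <= M ^+ 2 * n ^+ 2.
  move=> ?; rewrite -exprMn; apply: lerXn2r; rewrite ?nnegrE ?mulr_ge0 ?normr_ge0//.
  by apply: p_bound; lra.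
have E1 s : g1 s = g s + p z (s - a) by rewrite /g1 scale1r.
have E2 s : g2 s = g s - p z (s - a) by rewrite /g2 scaleN1r.
have H : \int[mu]_(s in `[a, T]) running u g1 s + \int[mu]_(s in `[a, T]) running u g2 s <=
   2 * \int[mu]_(s in `[a, T]) running u g s + c * (M ^+ 2 * n ^+ 2) * (T - a).
  rewrite -RintegralZl// -Rintegral_itv_cst// -!RintegralD//; last 2 first.
  - exact: integrable_itvZ.
  - exact: integrable_itv_cst.
  apply: le_Rintegral => //.
  - exact: integrable_itvD.
  - by apply: integrable_itvD; [exact: integrable_itvZ|exact: integrable_itv_cst].
  move=> s; rewrite /= in_itv/= => sT; rewrite /running E1 E2 -lerBlDl.
  apply: le_trans (F_semiconcave _ _ _ _) _; first by lra.
  by rewrite ler_wpM2l// dp.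
have HG : G (g1 T) + G (g2 T) <= 2 * G (g T) + c * (M ^+ 2 * n ^+ 2).
  rewrite E1 E2 -lerBlDl; apply: le_trans (G_semiconcave _ _) _.
  by rewrite ler_wpM2l// dp//; lra.
have : c * (M ^+ 2 * n ^+ 2) * (T - a) <= c * (M ^+ 2 * n ^+ 2) * T.
  by apply: ler_wpM2l; [rewrite !mulr_ge0 ?sqr_ge0//|lra].
rewrite /total_cost in h *; rewrite /value_sc; lra.
Qed.

Lemma integrable_normr_control a b u : Lp_control 2 a b u ->
  mu.-integrable `[a, b] (EFin \o (fun s => `|u s|)).
Proof.
move=> Lu; have [mu_ _] := Lu.
apply: (@le_integrable_itv _ _ _ _ (fun s => 1 + `|u s| ^+ 2)).
- exact: measurable_normr_cV.
- move=> s _; rewrite normr_id; have := sqr_ge0 (`|u s| - 1); nra.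
- exact: integrable_energy.
Qed.

(* Gronwall's inequality on a short interval, from the maximum of [|g|]. *)
Lemma trajectory_drift a b y u g : a <= b -> bA * (b - a) <= 1 / 2 ->
  Lp_control 2 a b u -> traj a b y u g ->
  `|g b - y| <= 2 * (bA * (b - a)) * `|y| +
                2 * (bB * \int[mu]_(s in `[a, b]) `|u s|).
Proof.
move=> ab bab Lu [cg gE].
have iu := Lp_control2_integrable Lu.
have inu := integrable_normr_control Lu.
set U := \int[mu]_(s in `[a, b]) `|u s|.
have bA0 : 0 <= bA := mx_bound_ge0 _.
have bB0 : 0 <= bB := mx_bound_ge0 _.
have cng : {within `[a, b], continuous (fun s => `|g s|)}.
  by move=> s; apply: cvg_norm; exact: cg.
have [m mab gm] := EVT_max ab cng.
set S := `|g m|.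
have S0 : 0 <= S := normr_ge0 _.
have U0 : 0 <= U by apply: Rintegral_ge0.
have key s : s \in `[a, b] -> `|g s - y| <= bA * (b - a) * S + bB * U.
  move=> sab; rewrite gE// addrAC subrr add0r.
  have /andP[as_ sb] : a <= s <= b by move: sab; rewrite in_itv.
  apply: normr_cV_le => [|i].
    by rewrite addr_ge0// !mulr_ge0// subr_ge0.
  have iv := integrable_velocity A B i cg iu.
  have ivs : mu.-integrable `[a, s] (EFin \o (fun s => (A *m g s + B *m u s) i 0)).
    exact: integrable_itvS iv.
  rewrite mxE; apply: le_trans (le_normr_Rintegral _ ivs) _ => //.
  have ih : mu.-integrable `[a, b] (EFin \o (fun s => bA * S + bB * `|u s|)).
    by apply: integrable_itvD; [exact: integrable_itv_cst|exact: integrable_itvZ].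
  apply: (@le_trans _ _ (\int[mu]_(s in `[a, s]) (bA * S + bB * `|u s|))).
    apply: le_Rintegral => //.
    - exact: integrable_norm.
    - exact: integrable_itvS ih.
    - move=> r; rewrite /= in_itv/= => /andP[ar rs].
      apply: le_trans (normr_coord_le _ _) _.
      apply: le_trans (ler_normD _ _) _; apply: lerD.
        apply: le_trans (normr_mulmx_le _ _) _.
        by rewrite ler_wpM2l// gm// in_itv/= ar (le_trans rs sb).
      exact: normr_mulmx_le.
  apply: (@le_trans _ _ (\int[mu]_(s in `[a, b]) (bA * S + bB * `|u s|))).
    rewrite [leRHS](@Rintegral_itv_split _ _ a s b)// lerDl.
    by apply: Rintegral_ge0 => r _; rewrite addr_ge0// mulr_ge0.
  rewrite RintegralD//; [|exact: integrable_itv_cst|exact: integrable_itvZ].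
  by rewrite Rintegral_itv_cst// RintegralZl//; apply: lerD => //; lra.
have bU0 : 0 <= bB * U by rewrite mulr_ge0.
have SS : S <= `|y| + (bA * (b - a) * S + bB * U).
  have := ler_normD (g m - y) y; rewrite subrK -/S => /le_trans; apply.
  by rewrite addrC lerD2l key.
have bb : b \in `[a, b] by rewrite in_itv/= ab lexx.
have e0 : 0 <= bA * (b - a) by rewrite mulr_ge0// subr_ge0.
(* The interval is short enough for half of the maximum [S] to be absorbed on the left of [SS]. *)
have eS : bA * (b - a) * S <= 1 / 2 * S by apply: ler_wpM2r.
have S2 : S <= 2 * `|y| + 2 * (bB * U) by lra.
have := key b bb => /le_trans; apply.
have h1 : bA * (b - a) * S <= bA * (b - a) * (2 * `|y| + 2 * (bB * U)).
  exact: ler_wpM2l.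
have h2 : bA * (b - a) * (bB * U) <= 1 / 2 * (bB * U) by apply: ler_wpM2r.
lra.
Qed.

(** * Energy, drift and second differences on short time intervals *)

Section short_time.
Variable rho : R.
Hypothesis rho_ge0 : 0 <= rho.

(** The constant l^2 / (2 a0) of Young's inequality l v <= (a0 / 2) v^2 + l^2 / (2 a0), where l is
    the factor of the integral of |u| in the energy estimate. *)
Definition young_const : R := (2 * value_lip * bB) ^+ 2 / (2 * a0).

(** The factor [2 / a0] undoes the half of the coercivity left after Young's inequality. Inside,
    [2 * c] comes from the null control and from coercivity, 1 from near-optimality and the
    [value_lip] term from the drifts of the two end points. The last 1 accounts for the constant in
    1 + |u|^2. *)
Definition short_energy : R :=
  2 / a0 * (2 * c + 1 + value_lip * (M * rho + 2 * bA * rho) + young_const) + 1.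

Lemma short_energy_ge1 : 1 <= short_energy.
Proof.
have L0 := value_lip_ge0; have bA0 := mx_bound_ge0 A.
rewrite /short_energy lerDr mulr_ge0//; first by rewrite divr_ge0// ltW.
have h1 : 0 <= young_const by rewrite /young_const divr_ge0 ?sqr_ge0// mulr_ge0// ltW.
have h2 : 0 <= value_lip * (M * rho + 2 * bA * rho).
  by rewrite mulr_ge0// addr_ge0// !mulr_ge0.
by rewrite !addr_ge0// mulr_ge0.
Qed.

(* [u] is compared with the null control on [[t, t + e]]; the two end points then
   differ by [O(e + int |u|)], which Young's inequality absorbs in the coercivity. *)
Lemma short_time_energy t e x u g : 0 <= t -> 0 < e -> e <= 1 -> t + e <= T ->
  bA * e <= 1 / 2 -> `|x| <= rho -> admissible t x u g ->
  total_cost t u g <= W t x + e ^+ 2 ->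
  \int[mu]_(s in `[t, (t + e)]) (1 + `|u s| ^+ 2) <= short_energy * e.
Proof.
move=> t0 e0 e1 teT bAe xrho adm h.
have [Lu tg] := adm.
have te : t <= t + e by lra.
have tT : 0 <= t <= T by lra.
have teT' : 0 <= t + e <= T by lra.
have e0T : 0 <= e <= T by lra.
have Lue : Lp_control 2 t (t + e) u by apply: Lp_control2_sub Lu.
have tge : traj t (t + e) x u g.
  have := trajectory_restrict (lexx t) te teT (Lp_control2_integrable Lu) tg.
  by rewrite (trajectory_start _ tg)//; lra.
have [cg _] := tge.
have ep : e = t + e - t by rewrite addrC addrA addNr add0r.
have h1 := dynamic_programming_ge t0 te teT adm.
have tp : traj t (t + e) x (fun=> 0) (fun s => p x (s - t)).
  by apply: p_traj_from; lra.
have h2 := dynamic_programming_le t0 te teT (Lp_control2_0 _ _) tp.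
have h3 : \int[mu]_(s in `[t, (t + e)]) running (fun=> 0) (fun s => p x (s - t)) s <= c * e.
  rewrite [in leRHS]ep; apply: Rintegral_itv_le_cst => //.
    by apply: (running_integrable t0 teT (Lp_control2_0 _ _)); case: tp.
  move=> s; rewrite in_itv/= => /andP[ts ste].
  apply: le_trans (F_growth _ _ _) _; first by rewrite (le_trans t0 ts) (le_trans ste).
  by rewrite normr0 expr0n/= addr0 mulr1.
have h4 := coercive_integral t0 te teT Lue cg.
rewrite -ep in h2 h4.
have h5 := optimal_value_lipschitz (g (t + e)) (p x e) teT'.
set Q := \int[mu]_(s in `[t, (t + e)]) `|u s| ^+ 2 in h4 *.
set U := \int[mu]_(s in `[t, (t + e)]) `|u s|.
have Q0 : 0 <= Q by apply: Rintegral_ge0 => s _; exact: sqr_ge0.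
have bAe' : bA * (t + e - t) <= 1 / 2 by rewrite -ep.
have h6 := trajectory_drift te bAe' Lue tge; rewrite -ep -/U in h6.
(* Both end points are compared with the common starting point [x]. *)
have h7 : `|p x e - g (t + e)| <= M * e * rho + (2 * (bA * e) * rho + 2 * (bB * U)).
  rewrite -[X in `|X|](_ : (p x e - x) - (g (t + e) - x) = _); last first.
    by rewrite opprB addrA subrK.
  apply: le_trans (ler_normB _ _) _; apply: lerD.
    apply: le_trans (p_drift _ e0T) _.
    by rewrite ler_wpM2l// mulr_ge0// ltW.
  by apply: le_trans h6 _; rewrite lerD2r ler_wpM2l// !mulr_ge0 ?mx_bound_ge0// ltW.
have L0 := value_lip_ge0.
have h8 : value_lip * `|p x e - g (t + e)| <=
    value_lip * (M * e * rho + (2 * (bA * e) * rho + 2 * (bB * U))).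
  exact: ler_wpM2l.
have h9 : 2 * value_lip * bB * U <= a0 / 2 * Q + young_const * e.
  have /Lp_control2P[_ iQ] := Lue.
  have iU := integrable_normr_control Lue.
  have -> : young_const * e = \int[mu]_(s in `[t, (t + e)]) young_const.
    by rewrite Rintegral_itv_cst// -ep.
  rewrite -!RintegralZl// -RintegralD//; [|exact: integrable_itvZ|exact: integrable_itv_cst].
  apply: le_Rintegral => //; first exact: integrable_itvZ.
    by apply: integrable_itvD; [exact: integrable_itvZ|exact: integrable_itv_cst].
  move=> s _; rewrite /young_const.
  set l := 2 * value_lip * bB; set v := `|u s|.
  have -> : a0 / 2 * v ^+ 2 + l ^+ 2 / (2 * a0) =
      l * v + (a0 * v - l) ^+ 2 / (2 * a0).
    by field; rewrite gt_eqF.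
  by rewrite lerDl divr_ge0 ?sqr_ge0// mulr_ge0// ltW.
have he2 : e ^+ 2 <= e by rewrite expr2 ler_piMr// ltW.
rewrite (Rintegral_energy te Lue) -ep -/Q.
have h10 : a0 / 2 * Q <= (2 * c + 1 + value_lip * (M * rho + 2 * bA * rho) + young_const) * e.
  lra.
have : Q <= 2 / a0 * ((2 * c + 1 + value_lip * (M * rho + 2 * bA * rho) + young_const) * e).
  rewrite -(ler_pM2l (_ : 0 < a0 / 2)) ?divr_gt0//.
  apply: le_trans h10 _.
  by rewrite [leRHS]mulrA (_ : a0 / 2 * (2 / a0) = 1) ?mul1r//; field; rewrite gt_eqF.
rewrite /short_energy; lra.
Qed.

Definition short_drift : R := 2 * bA * rho + 2 * (bB * short_energy).

Lemma short_drift_ge0 : 0 <= short_drift.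
Proof.
have := short_energy_ge1; have bA0 := mx_bound_ge0 A; have bB0 := mx_bound_ge0 B.
move=> h; rewrite /short_drift addr_ge0// !mulr_ge0//; lra.
Qed.

Lemma short_time_drift t e x u g : 0 <= t -> 0 < e -> e <= 1 -> t + e <= T ->
  bA * e <= 1 / 2 -> `|x| <= rho -> admissible t x u g ->
  total_cost t u g <= W t x + e ^+ 2 ->
  `|g (t + e) - x| <= short_drift * e.
Proof.
move=> t0 e0 e1 teT bAe xrho adm h.
have E := short_time_energy t0 e0 e1 teT bAe xrho adm h.
have [Lu tg] := adm.
have te : t <= t + e by lra.
have Lue : Lp_control 2 t (t + e) u by apply: Lp_control2_sub Lu.
have tge : traj t (t + e) x u g.
  have := trajectory_restrict (lexx t) te teT (Lp_control2_integrable Lu) tg.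
  by rewrite (trajectory_start _ tg)//; lra.
have ep : e = t + e - t by rewrite addrC addrA addNr add0r.
have bAe' : bA * (t + e - t) <= 1 / 2 by rewrite -ep.
have := trajectory_drift te bAe' Lue tge; rewrite -ep => /le_trans; apply.
set U := \int[mu]_(s in `[t, (t + e)]) `|u s|.
have UE : U <= short_energy * e.
  apply: le_trans E; apply: le_Rintegral => //.
  - exact: integrable_normr_control.
  - exact: integrable_energy.
  - move=> s _; have := sqr_ge0 (`|u s| - 1); have := normr_ge0 (u s); nra.
have bA0 := mx_bound_ge0 A; have bB0 := mx_bound_ge0 B.
have : bB * U <= bB * (short_energy * e) by exact: ler_wpM2l.
have : bA * e * `|x| <= bA * e * rho by rewrite ler_wpM2l// mulr_ge0// ltW.
rewrite /short_drift; lra.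
Qed.

(** One summand per source of error: time shift of the running cost, its shifts in space,
    near-optimality (doubled, since the value at (t, x) counts twice), distance of the midpoint from
    the end point of [u], and semiconcavity in space. *)
Definition time_const : R :=
  c + c * M * short_energy * (1 + short_drift + M) + 2 +
  value_lip * M * (short_drift + M + 1) +
  value_sc * ((1 + M) ^+ 2 * (short_drift ^+ 2 + M ^+ 2) + M ^+ 2).

Lemma time_const_ge0 : 0 <= time_const.
Proof.
have := short_energy_ge1; have := short_drift_ge0; have := value_lip_ge0.
have := value_sc_ge0 => h1 h2 h3 h4; have h5 : 0 <= short_energy by lra.
rewrite /time_const; repeat first
  [assumption|exact: ler01|exact: ler0n|apply: sqr_ge0|apply: addr_ge0|apply: mulr_ge0].
Qed.

(* The quantities of [short_time_semiconcave] combine by Young's inequality;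
   here [n] stands for [|h|], [m] for [|y1 - x|] and [D] for [e * sqrt e]. *)
Lemma time_const_le e n m D : 0 < e -> 0 <= n -> 0 <= m ->
  e ^+ 2 <= D -> e <= 1 -> m <= short_drift * e + M * n ->
  c * D + c * M * n * (short_energy * e) + c * M * m * (short_energy * e) +
  2 * e ^+ 2 + value_lip * (M * e * (m + n)) +
  value_sc * (((1 + M) * m + M * n) / 2) ^+ 2 <= time_const * (n ^+ 2 + D).
Proof.
move=> e0 n0 m0 eD e1 mle.
have SE := short_energy_ge1; have SD := short_drift_ge0; have VL := value_lip_ge0.
have VS := value_sc_ge0.
set H := n ^+ 2 + D.
have n2 : 0 <= n ^+ 2 := sqr_ge0 _.
have e2 : 0 <= e ^+ 2 := sqr_ge0 _.
have D0 : 0 <= D by lra.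
have en : e * n <= H by rewrite /H; have := sqr_ge0 (e - n); nra.
have em : e * m <= (short_drift + M) * H.
  apply: le_trans (_ : e * (short_drift * e + M * n) <= _); first by rewrite ler_wpM2l// ltW.
  rewrite mulrDr [leRHS]mulrDl; apply: lerD.
    rewrite mulrCA -expr2 ler_wpM2l// /H; lra.
  by rewrite mulrCA ler_wpM2l.
have mm : m ^+ 2 <= 2 * (short_drift ^+ 2 + M ^+ 2) * H.
  apply: (@le_trans _ _ ((short_drift * e + M * n) ^+ 2)).
    by rewrite lerXn2r ?nnegrE// addr_ge0// mulr_ge0// ltW.
  apply: (@le_trans _ _ (2 * (short_drift ^+ 2 * e ^+ 2 + M ^+ 2 * n ^+ 2))).
    have := sqr_ge0 (short_drift * e - M * n); nra.
  rewrite -mulrA ler_wpM2l// mulrDl; apply: lerD; apply: ler_wpM2l; rewrite ?sqr_ge0// /H; lra.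
have sq : (((1 + M) * m + M * n) / 2) ^+ 2 <=
    ((1 + M) ^+ 2 * (short_drift ^+ 2 + M ^+ 2) + M ^+ 2) * H.
  apply: (@le_trans _ _ (((1 + M) ^+ 2 * m ^+ 2 + M ^+ 2 * n ^+ 2) / 2)).
    have := sqr_ge0 ((1 + M) * m - M * n); nra.
  have h1 : (1 + M) ^+ 2 * m ^+ 2 <= (1 + M) ^+ 2 * (2 * (short_drift ^+ 2 + M ^+ 2) * H).
    by rewrite ler_wpM2l// sqr_ge0.
  have h2 : M ^+ 2 * n ^+ 2 <= M ^+ 2 * (2 * H).
    by rewrite ler_wpM2l ?sqr_ge0// /H; lra.
  lra.
have t1 : c * D <= c * H by rewrite ler_wpM2l// /H; lra.
have cMS : 0 <= c * M * short_energy by rewrite !mulr_ge0//; lra.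
have t2 : c * M * short_energy * (e * n) <= c * M * short_energy * H by rewrite ler_wpM2l.
have t3 : c * M * short_energy * (e * m) <= c * M * short_energy * ((short_drift + M) * H).
  by rewrite ler_wpM2l.
have VLM : 0 <= value_lip * M by rewrite mulr_ge0.
have t4 : value_lip * M * (e * n) <= value_lip * M * H by rewrite ler_wpM2l.
have t5 : value_lip * M * (e * m) <= value_lip * M * ((short_drift + M) * H) by rewrite ler_wpM2l.
have t6 := ler_wpM2l VS sq.
have t7 : e ^+ 2 <= H by rewrite /H; lra.
rewrite /time_const; clear mm sq em en; lra.
Qed.

(* The control of [u] on [[t, t + e]] is run twice from [x - h] on
   [[t - e, t + e]]: since the system is autonomous, the corresponding
   trajectory is a translate of [g] plus solutions of the homogeneous system. *)
Lemma short_time_semiconcave t e x h : 0 < e -> e <= 1 -> bA * e <= 1 / 2 ->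
  0 <= t - e -> t + e <= T -> `|x| <= rho ->
  W (t + e) (x + h) + W (t - e) (x - h) - 2 * W t x <=
  time_const * (`|h| ^+ 2 + e * Num.sqrt e).
Proof.
move=> e0 e1 bAe te0 teT xrho.
have t0 : 0 <= t by lra.
have tT : 0 <= t <= T by lra.
have teT' : 0 <= t + e <= T by lra.
have te : t <= t + e by lra.
have tet : t - e <= t by lra.
have tleT : t <= T by lra.
have e0T : 0 <= e <= T by lra.
have ep : t + e - t = e by rewrite addrC addrA addNr add0r.
have e2 : 0 < e ^+ 2 by rewrite exprn_gt0.
have [u [g [adm hopt]]] := optimal_value_approx x tT e2.
have E := short_time_energy t0 e0 e1 teT bAe xrho adm hopt.
have Dr := short_time_drift t0 e0 e1 teT bAe xrho adm hopt.
have DP := dynamic_programming_ge t0 te teT adm.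
have [Lu tg] := adm.
have Lue : Lp_control 2 t (t + e) u by apply: Lp_control2_sub Lu.
have tge : traj t (t + e) x u g.
  have := trajectory_restrict (lexx t) te teT (Lp_control2_integrable Lu) tg.
  by rewrite (trajectory_start tleT tg).
have iue := Lp_control2_integrable Lue.
have [cg _] := tge.
set y0 := g (t + e) in Dr DP.
set I0 := \int[mu]_(s in `[t, (t + e)]) running u g s in DP.
have iI0 := running_integrable t0 teT Lue cg.
have se : 0 <= e * Num.sqrt e by rewrite mulr_ge0 ?sqrtr_ge0// ltW.
have e2se : e ^+ 2 <= e * Num.sqrt e.
  rewrite expr2 ler_pM2l// -[leLHS](ger0_norm (ltW e0)) -sqrtr_sqr ler_wsqrtr//.
  by rewrite expr2 ler_piMr// ltW.
(* The first run, still on [t, t + e]: same control, started at [x - h]. Translation by [e] then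
   moves it to [t - e, t]. *)
pose g1 s := g s - p h (s - t).
have tg1 : traj t (t + e) (x - h) u g1.
  have tp : traj t (t + e) h (fun=> 0) (fun s => p h (s - t)).
    by apply: p_traj_from; rewrite ep; case/andP : e0T.
  have := trajectory_linear (-1) iue tge tp.
  by rewrite scaleN1r; under [X in trajectory _ _ _ _ _ _ X]funext do rewrite scaleN1r.
have := trajectory_translate e iue tg1; rewrite addrK => tq.
have Lq := Lp_control2_translate e Lue; rewrite addrK in Lq.
have := dynamic_programming_le te0 tet tleT Lq tq.
have -> : g1 (t + e) = y0 - p h e by rewrite /g1 ep.
set y1 := y0 - p h e => S1.
(* The first run ends at [y1], so the second one is [g] shifted by the homogeneous solution from
   [z]. *)
set z := y1 - x.
have tg2 : traj t (t + e) y1 u (fun s => g s + 1 *: p z (s - t)).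
  have tp : traj t (t + e) z (fun=> 0) (fun s => p z (s - t)).
    by apply: p_traj_from; rewrite ep; case/andP : e0T.
  have := trajectory_linear 1 iue tge tp.
  by rewrite scale1r [x + z]addrC subrK.
have S2 := dynamic_programming_le t0 te teT Lue tg2.
rewrite ep scale1r -/y0 in S2.
have nh0 := normr_ge0 h; have nz0 := normr_ge0 z.
have c1 : \int[mu]_(s in `[(t - e), t]) running (fun s => u (s + e)) (fun s => g1 (s + e)) s <=
    I0 + (c * Num.sqrt e * e + c * (M * `|h|) * (short_energy * e)).
  (* Read on [t, t + e], the first run pays the cost of time [s - e]; it differs from the cost along
     [g] by a time shift [e] and a space shift [p h (s - t)]. *)
  pose Phi s := F (s - e) (g1 s) (u s).
  have iq : mu.-integrable `[t - e, t] (EFin \o running (fun s => u (s + e)) (fun s => g1 (s + e))).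
    by case: tq => cq _; exact: (running_integrable te0 tleT Lq cq).
  have iPhi : mu.-integrable `[t, t + e] (EFin \o Phi).
    have := integrable_translate (- e) iq; rewrite !opprK subrK.
    by apply: eq_integrable => // s _ /=; rewrite /running subrK.
  have -> : \int[mu]_(s in `[(t - e), t]) running (fun s => u (s + e)) (fun s => g1 (s + e)) s =
      \int[mu]_(s in `[t, (t + e)]) Phi s.
    have /integrableP[/measurable_EFinP mPhi _] := iPhi.
    rewrite -(Rintegral_translate e mPhi) addrK.
    by apply: eq_Rintegral => s _; rewrite /Phi /running addrK.
  have ce : 0 <= c * (M * `|h|) by rewrite !mulr_ge0.
  apply: (le_trans (@Rintegral_running_diff_le t (t + e) u Phi (running u g)
      (c * Num.sqrt e) (c * (M * `|h|)) te Lue iPhi iI0 _)); last first.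
    by rewrite ep lerD2l lerD2l ler_wpM2l.
  move=> s; rewrite in_itv/= => /andP[ts ste].
  have [sT [seT st]] := time_bounds e0 te0 teT ts ste.
  rewrite /Phi /running.
  have h1 := F_time (g1 s) (u s) seT sT.
  rewrite addrAC subrr sub0r normrN (gtr0_norm e0) in h1.
  have h2 := F_lipschitz (g1 s) (g s) (u s) sT.
  rewrite /g1 addrAC subrr sub0r normrN -/(g1 s) in h2.
  have h3 : c * (1 + `|u s| ^+ 2) * `|p h (s - t)| <= c * (1 + `|u s| ^+ 2) * (M * `|h|).
    by rewrite ler_wpM2l ?p_bound// mulr_ge0// addr_ge0// sqr_ge0.
  move: h1; rewrite ler_norml => /andP[_ h1].
  exact: (chain_bound h1 h2 h3).
have c2 : \int[mu]_(s in `[t, (t + e)]) running u (fun s => g s + 1 *: p z (s - t)) s <=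
    I0 + c * (M * `|z|) * (short_energy * e).
  have i2 : mu.-integrable `[t, t + e] (EFin \o running u (fun s => g s + 1 *: p z (s - t))).
    by case: tg2 => c2 _; exact: (running_integrable t0 teT Lue c2).
  have ce : 0 <= c * (M * `|z|) by rewrite !mulr_ge0.
  apply: (le_trans (@Rintegral_running_diff_le t (t + e) u _ (running u g)
      0 (c * (M * `|z|)) te Lue i2 iI0 _)); last first.
    by rewrite mul0r add0r lerD2l ler_wpM2l.
  move=> s; rewrite in_itv/= => /andP[ts ste].
  have [sT [_ st]] := time_bounds e0 te0 teT ts ste.
  rewrite /running scale1r.
  have h2 := F_lipschitz (g s + p z (s - t)) (g s) (u s) sT.
  rewrite addrAC subrr add0r in h2.
  have h3 : c * (1 + `|u s| ^+ 2) * `|p z (s - t)| <= c * (1 + `|u s| ^+ 2) * (M * `|z|).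
    by rewrite ler_wpM2l ?p_bound// mulr_ge0// addr_ge0// sqr_ge0.
  by rewrite add0r -lerBlDl (le_trans h2)// (le_trans h3)// mulrAC.
have zle : `|z| <= short_drift * e + M * `|h|.
  rewrite /z /y1 addrAC; apply: le_trans (ler_normB _ _) _.
  by apply: lerD => //; exact: p_bound.
pose yp := x + h; pose ym := y0 + p z e.
(* Semiconcavity in space needs a symmetric pair, hence the exact midpoint; the Lipschitz bound then
   replaces [mid] by [y0], where dynamic programming for [u] applies. *)
pose mid := 2^-1 *: (yp + ym); pose dif := 2^-1 *: (yp - ym).
have Ep : yp = mid + dif := esym (midpoint_addl yp ym).
have Em : ym = mid - dif := esym (midpoint_subl yp ym).
have sc := optimal_value_semiconcave mid dif teT'.
rewrite -Ep -Em in sc.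
have lip := optimal_value_lipschitz y0 mid teT'.
have ph := p_drift h e0T; have pz := p_drift z e0T.
have pzb := p_bound z e0T.
have xy0 : x - y0 = - z - p h e by rewrite /z /y1 !opprB addrCA [p h e + _]addrC addrK.
have Nmid : `|mid - y0| <= (M * e * (`|z| + `|h|)) / 2.
  have -> : mid - y0 = 2^-1 *: ((p z e - z) - (p h e - h)).
    exact: midpoint_defect.
  rewrite normrZ ger0_norm ?invr_ge0// mulrC ler_wpM2r ?invr_ge0//.
  by apply: le_trans (ler_normB _ _) _; rewrite mulrDr lerD.
have Ndif : `|dif| <= ((1 + M) * `|z| + M * `|h|) / 2.
  have -> : dif = 2^-1 *: (- (z + p z e) - (p h e - h)).
    exact: half_difference.
  rewrite normrZ ger0_norm ?invr_ge0// mulrC ler_wpM2r ?invr_ge0//.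
  apply: le_trans (ler_normB _ _) _; rewrite normrN; apply: lerD.
    by apply: le_trans (ler_normD _ _) _; rewrite mulrDl mul1r lerD2l.
  apply: le_trans ph _; rewrite ler_wpM2r//.
  by rewrite ler_piMr.
have VL := value_lip_ge0; have VS := value_sc_ge0.
have lip' : value_lip * `|mid - y0| <= value_lip * (M * e * (`|z| + `|h|) / 2).
  exact: ler_wpM2l.
have sc' : value_sc * `|dif| ^+ 2 <= value_sc * (((1 + M) * `|z| + M * `|h|) / 2) ^+ 2.
  apply: ler_wpM2l => //; apply: lerXn2r => //; rewrite nnegrE//.
  by rewrite divr_ge0// addr_ge0// mulr_ge0// addr_ge0.
have fin := time_const_le e0 nh0 nz0 e2se e1 zle.
apply: le_trans fin.
rewrite -/ym in S2; rewrite -/yp.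
exact: (combine_bounds S1 S2 c1 c2 sc lip lip' sc' DP hopt).
Qed.

End short_time.

(** A time increment below this is at most 1 and satisfies [bA * e <= 1 / 2], the smallness required
    by [trajectory_drift]. *)
Definition time_step : R := (2 * bA + 1)^-1.

(** The three terms serve 0 < e <= [time_step], e = 0, and e > [time_step]; in the last case the
    left side is at most [4 * value_bound] and e^(3/2) is bounded below. *)
Definition semiconcavity_const (rho : R) : R :=
  time_const rho + value_sc + 4 * value_bound / (time_step * Num.sqrt time_step).

Lemma semiconcavity_const_ge0 rho : 0 <= rho -> 0 <= semiconcavity_const rho.
Proof.
move=> rho0; have bA0 : 0 <= bA := mx_bound_ge0 _.
have st0 : 0 <= time_step by rewrite invr_ge0 addr_ge0// mulr_ge0.
apply: addr_ge0; first exact: addr_ge0 (time_const_ge0 rho0) value_sc_ge0.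
by apply: divr_ge0; rewrite mulr_ge0// ?value_bound_ge0// sqrtr_ge0.
Qed.

Lemma semiconcave_forward rho t e x h : 0 <= rho -> 0 <= e ->
  0 <= t - e -> t + e <= T -> `|x| <= rho ->
  W (t + e) (x + h) + W (t - e) (x - h) - 2 * W t x <=
  semiconcavity_const rho * (`|h| ^+ 2 + e * Num.sqrt e).
Proof.
move=> rho0 e0 te0 teT xrho.
have bA0 : 0 <= bA := mx_bound_ge0 _.
have den0 : 0 < 2 * bA + 1 by rewrite ltr_wpDl// mulr_ge0.
have st0 : 0 < time_step by rewrite invr_gt0.
have D0 : 0 < time_step * Num.sqrt time_step by rewrite mulr_gt0// sqrtr_gt0.
have TC := time_const_ge0 rho0; have VS := value_sc_ge0; have VB := value_bound_ge0.
have VD : 0 <= 4 * value_bound / (time_step * Num.sqrt time_step).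
  by apply: divr_ge0 (ltW D0); rewrite mulr_ge0.
set D := e * Num.sqrt e.
have De : 0 <= D by rewrite mulr_ge0// sqrtr_ge0.
have h2 : 0 <= `|h| ^+ 2 := sqr_ge0 _.
have S0 : 0 <= `|h| ^+ 2 + D by rewrite addr_ge0.
have [e_eq0|e_neq0] := eqVneq e 0.
  have tT : 0 <= t <= T by rewrite e_eq0 subr0 addr0 in te0 teT; rewrite te0.
  have := optimal_value_semiconcave x h tT.
  rewrite /D e_eq0 !mul0r subr0 !addr0 => H.
  rewrite lerBlDl (le_trans H)// lerD2l ler_wpM2r// /semiconcavity_const.
  by rewrite -addrA addrCA lerDl addr_ge0.
have e_gt0 : 0 < e by rewrite lt_neqAle eq_sym e_neq0.
have [eS|Se] := leP e time_step.
  have e1 : e <= 1 by rewrite (le_trans eS)// invf_le1// lerDr mulr_ge0.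
  have bAe : bA * e <= 1 / 2.
    apply: (@le_trans _ _ (bA * time_step)); first by rewrite ler_wpM2l.
    by rewrite ler_pdivrMr//; lra.
  apply: le_trans (short_time_semiconcave rho0 h e_gt0 e1 bAe te0 teT xrho) _.
  by rewrite ler_wpM2r// /semiconcavity_const -addrA lerDl addr_ge0.
have tp : 0 <= t + e <= T.
  by rewrite teT andbT (le_trans te0)// lerD2l ge0_cp.
have tm : 0 <= t - e <= T.
  by rewrite te0 (le_trans _ teT)// lerD2l ge0_cp.
have tT : 0 <= t <= T.
  by rewrite (le_trans te0) ?(le_trans _ teT) ?lerDl// gerBl.
have := optimal_value_bounded (x + h) tp; rewrite ler_norml => /andP[_ v1].
have := optimal_value_bounded (x - h) tm; rewrite ler_norml => /andP[_ v2].
have := optimal_value_bounded x tT; rewrite ler_norml => /andP[v3 _].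
have DD : time_step * Num.sqrt time_step <= D.
  by apply: ler_pM; [exact: ltW|exact: sqrtr_ge0|exact: ltW|apply: ler_wsqrtr; exact: ltW].
have H : 4 * value_bound <= 4 * value_bound / (time_step * Num.sqrt time_step) * D.
  have VB4 : 0 <= 4 * value_bound by rewrite mulr_ge0.
  by rewrite -[leRHS]mulrA ler_peMr// mulrC ler_pdivlMr// mul1r.
apply: (@le_trans _ _ (4 * value_bound)); first by lra.
apply: le_trans H _; rewrite /semiconcavity_const; apply: ler_pM => //.
  by rewrite lerDr addr_ge0.
by rewrite lerDr.
Qed.

Theorem optimal_value_semiconcave_time rho t e x h : 0 <= rho ->
  0 <= t + e <= T -> 0 <= t - e <= T -> `|x| <= rho ->
  W (t + e) (x + h) + W (t - e) (x - h) - 2 * W t x <=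
  semiconcavity_const rho * (`|h| ^+ 2 + `|e| * Num.sqrt `|e|).
Proof.
move=> rho0 /andP[te0 teT] /andP[tme0 tmeT] xrho; have [e0|e0] := leP 0 e.
  by rewrite ger0_norm//; exact: semiconcave_forward.
have Ne0 : 0 <= - e by rewrite oppr_ge0 ltW.
(* The second difference is invariant under (e, h) -> (-e, -h), which reduces a negative increment
   to a positive one. *)
rewrite ler0_norm ?(ltW e0)// -(normrN h) [X in X - _]addrC.
have := @semiconcave_forward rho t (- e) x (- h) rho0 Ne0.
by rewrite !opprK; apply.
Qed.

End control_problem.

(** * The homogeneous system *)

Section homogeneous.
Context {R : realType} {d : nat}.
Variable A : 'M[R]_d.
Local Notation mu := (@lebesgue_measure R).
Implicit Types (z : 'cV[R]_d) (s K : R) (i j : 'I_d).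

(** The coordinate i of A^n z / n!. Working coordinatewise, exp(s A) z becomes a family of real
    power series, dominated by the scalar exponential series. *)
Definition exp_coef z i (n : nat) : R := iter n (mulmx A) z i 0 / n`!%:R.

Definition exp_curve z s : 'cV[R]_d := \col_i limn (pseries (exp_coef z i) s).

Lemma norm_exp_coef z i n K :
  `|exp_coef z i n * K ^+ n| <= `|z| * exp_coeff (mx_bound A * `|K|) n.
Proof.
have H : `|iter n (mulmx A) z| <= (mx_bound A) ^+ n * `|z|.
  elim: n => [|n IH]; first by rewrite expr0 mul1r.
  rewrite iterS (le_trans (normr_mulmx_le _ _))// exprS -mulrA.
  by rewrite ler_wpM2l// mx_bound_ge0.
rewrite /exp_coef /exp_coeff/= !normrM normfV normr_nat normrX exprMn.
rewrite mulrAC !mulrA ler_wpM2r ?invr_ge0// ler_wpM2r ?exprn_ge0//.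
by rewrite (le_trans (normr_coord_le _ _))// mulrC.
Qed.

Lemma is_cvg_normed_exp_coef z i K :
  cvgn [normed pseries (exp_coef z i) K].
Proof.
apply: (@series_le_cvg _ _ (`|z| *: exp_coeff (mx_bound A * `|K|))).
- by move=> n /=.
- move=> n; apply: le_trans (norm_exp_coef z i n K); exact: normr_ge0.
- by move=> n; exact: norm_exp_coef.
- by apply: is_cvg_seriesZ; exact: is_cvg_series_exp_coeff.
Qed.

Lemma is_cvg_exp_coef z i K : cvgn (pseries (exp_coef z i) K).
Proof. exact/normed_cvg/is_cvg_normed_exp_coef. Qed.

Lemma norm_exp_curve z s : `|exp_curve z s| <= `|z| * expR (mx_bound A * `|s|).
Proof.
apply: normr_cV_le => [|i]; first by rewrite mulr_ge0// expR_ge0.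
rewrite mxE /pseries.
have := @lim_series_norm _ _ (fun n => exp_coef z i n * s ^+ n) (@is_cvg_normed_exp_coef z i s).
move=> /le_trans; apply.
have cE := is_cvg_series_exp_coeff (mx_bound A * `|s|).
apply: (@le_trans _ _ (limn (series (`|z| *: exp_coeff (mx_bound A * `|s|))))).
  apply: lim_series_le; first exact: is_cvg_normed_exp_coef.
    exact: is_cvg_seriesZ.
  by move=> n; exact: norm_exp_coef.
by rewrite lim_seriesZ.
Qed.

(** Termwise differentiation amounts to replacing [z] by [A *m z], since (n + 1) / (n + 1)! = 1 /
    n!. *)
Lemma pseries_diffs_exp_coef z i :
  pseries_diffs (exp_coef z i) = exp_coef (A *m z) i.
Proof.
apply/funext => n; rewrite /pseries_diffs /exp_coef iterSr factS natrM invfM.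
by rewrite mulrCA; congr (_ * _); rewrite mulrA divff ?mul1r ?pnatr_eq0.
Qed.

Lemma exp_curve_comm z s : exp_curve (A *m z) s = A *m exp_curve z s.
Proof.
apply/colP => i; rewrite !mxE.
have -> : pseries (exp_coef (A *m z) i) s =
    \sum_j (A i j \o* (pseries (exp_coef z j) s)).
  apply/funext => n; rewrite fct_sumE /pseries /series /=.
  under [RHS]eq_bigr do rewrite mulr_suml.
  rewrite exchange_big/=; apply: eq_bigr => m _.
  rewrite /exp_coef -iterSr iterS mxE !mulr_suml; apply: eq_bigr => j _.
  by rewrite -!mulrA mulrC -!mulrA.
apply/cvg_lim => //.
have -> : \sum_j A i j * exp_curve z s j 0 =
    \sum_j limn (pseries (exp_coef z j) s) * A i j.
  by apply: eq_bigr => j _; rewrite mxE mulrC.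
have -> : \sum_j (A i j \o* pseries (exp_coef z j) s) =
    (fun n => \sum_j (pseries (exp_coef z j) s n * A i j)).
  by apply/funext => n; rewrite fct_sumE.
apply: cvg_big => [|j _]; first exact: add_continuous.
apply: cvgMl.
exact: is_cvg_exp_coef.
Qed.

Lemma is_derive_exp_curve z s i :
  is_derive s 1 (fun r => exp_curve z r i 0) ((A *m exp_curve z s) i 0).
Proof.
rewrite -exp_curve_comm mxE -pseries_diffs_exp_coef.
have -> : (fun r => exp_curve z r i 0) = (fun r => limn (pseries (exp_coef z i) r)).
  by apply/funext => r; rewrite mxE.
(* The series converge everywhere, so any radius beyond [|s|] will do. *)
apply: (@pseries_snd_diffs _ _ (`|s| + 1)); rewrite ?pseries_diffs_exp_coef;
  [exact: is_cvg_exp_coef..|].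
by rewrite [ltRHS]ger0_norm ?addr_ge0// ltrDl.
Qed.

Lemma continuous_exp_curve z i : continuous (fun r => exp_curve z r i 0).
Proof.
move=> s; apply/differentiable_continuous/derivable1_diffP.
by have [] := is_derive_exp_curve z s i.
Qed.

Lemma exp_curve0 z : exp_curve z 0 = z.
Proof.
apply/colP => i; rewrite mxE.
apply/cvg_lim => //; rewrite -(cvg_shiftn 1)/=.
have -> : (fun n => pseries (exp_coef z i) 0 (n + 1)%N) = cst (z i 0).
  apply/funext => n; rewrite /pseries /series/= addn1 big_nat_recl//= expr0 mulr1.
  rewrite big1 ?addr0 /exp_coef/= ?fact0 ?divr1// => m _.
  by rewrite exprS mul0r mulr0.
exact: cvg_cst.
Qed.

Lemma exp_curve_integral z s i : 0 <= s ->
  \int[mu]_(r in `[0, s]) ((A *m exp_curve z r) i 0) = exp_curve z s i 0 - z i 0.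
Proof.
rewrite le_eqVlt => /predU1P[<-|s0].
  by rewrite Rintegral_itv1 exp_curve0 subrr.
have cf : continuous (fun r => (A *m exp_curve z r) i 0).
  move=> r; have := @continuous_exp_curve (A *m z) i r.
  by under eq_fun do rewrite exp_curve_comm.
rewrite /Rintegral (@continuous_FTC2 _ _ (fun r => exp_curve z r i 0))//=.
- by rewrite exp_curve0.
- exact: continuous_subspaceT.
- split=> [r _| |].
  + by have [] := is_derive_exp_curve z r i.
  + by apply: cvg_at_right_filter; exact: continuous_exp_curve.
  + by apply: cvg_at_left_filter; exact: continuous_exp_curve.
- move=> r _; rewrite derive1E; exact: (@derive_val _ _ _ _ _ _ _ (is_derive_exp_curve z r i)).
Qed.

Lemma exp_curve_trajectory k (B : 'M[R]_(d, k)) T z :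
  trajectory A B 0 T z (fun=> 0) (exp_curve z).
Proof.
split.
  apply: continuous_subspaceT => s; apply/cvgrPdist_le => e e0.
  near=> r; apply: normr_cV_le => [|i]; first exact: ltW.
  rewrite mxE [X in _ + X]mxE; move: i; near: r; apply: filter_forall => i.
  have /cvgrPdist_le := @continuous_exp_curve z i s.
  exact.
move=> s; rewrite in_itv/= => /andP[s0 _]; apply/colP => i; rewrite !mxE.
under eq_Rintegral do rewrite mulmx0 addr0.
by rewrite exp_curve_integral// mxE addrC subrK.
Unshelve. all: by end_near. Qed.

(** One constant for two estimates: the summand 1 serves the bound on exp(s A) z, the summand
    [mx_bound A] the bound on its derivative and hence the drift. *)
Definition exp_bound (T : R) : R := (1 + mx_bound A) * expR (mx_bound A * T).

Lemma exp_bound_ge0 T : 0 <= exp_bound T.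
Proof. by rewrite mulr_ge0 ?expR_ge0// addr_ge0// mx_bound_ge0. Qed.

Lemma norm_exp_curve_le T z s : 0 <= s <= T ->
  `|exp_curve z s| <= expR (mx_bound A * T) * `|z|.
Proof.
move=> /andP[s0 sT]; apply: le_trans (norm_exp_curve z s) _.
by rewrite mulrC ler_wpM2r// ler_expR ger0_norm// ler_wpM2l// mx_bound_ge0.
Qed.

Lemma exp_curve_bound T z s : 0 <= s <= T -> `|exp_curve z s| <= exp_bound T * `|z|.
Proof.
move=> sT; apply: le_trans (norm_exp_curve_le z sT) _.
by rewrite ler_wpM2r// ler_peMl ?expR_ge0// lerDl mx_bound_ge0.
Qed.

Lemma exp_curve_drift T z s : 0 <= s <= T ->
  `|exp_curve z s - z| <= exp_bound T * s * `|z|.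
Proof.
move=> sT; have /andP[s0 s_le] := sT.
have bA := mx_bound_ge0 A.
apply: normr_cV_le => [|i].
  apply: mulr_ge0 => //; apply: mulr_ge0 => //; exact: exp_bound_ge0.
rewrite mxE [X in _ + X]mxE -exp_curve_integral//.
have ci : mu.-integrable `[0, s] (EFin \o (fun r => (A *m exp_curve z r) i 0)).
  apply: integrable_within_continuous; apply: continuous_subspaceT => r.
  have := @continuous_exp_curve (A *m z) i r.
  by under eq_fun do rewrite exp_curve_comm.
apply: le_trans (le_normr_Rintegral _ ci) _ => //.
rewrite mulrAC -[X in _ * X](subr0 s); apply: Rintegral_itv_le_cst => //.
  exact: integrable_norm.
move=> r; rewrite in_itv/= => /andP[r0 rs].
apply: le_trans (normr_coord_le _ _) _.
apply: le_trans (normr_mulmx_le _ _) _.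
have rT : 0 <= r <= T by rewrite r0 (le_trans rs).
apply: (@le_trans _ _ (mx_bound A * (expR (mx_bound A * T) * `|z|))).
  by rewrite ler_wpM2l// norm_exp_curve_le.
by rewrite mulrA ler_wpM2r// /exp_bound ler_wpM2r ?expR_ge0// lerDr.
Qed.

End homogeneous.

(** * Growth and Lipschitz bounds on the data *)

Section semiconcave_lipschitz.
Context {R : realType} {V : normedModType R}.

(* Concavity up to a quadratic term, used on the segment from [x - e] to [y]
   where [e] is the unit vector from [x] to [y]. *)
Lemma semiconcave_bounded_lipschitz (f : V -> R) (K w : R) : 0 <= K -> 0 <= w ->
  (forall x y, `|f x - f y| <= K) ->
  (forall lam x0 x1, 0 <= lam <= 1 ->
    lam * f x0 + (1 - lam) * f x1 - f (lam *: x0 + (1 - lam) *: x1) <=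
    w * lam * (1 - lam) * `|x0 - x1| ^+ 2) ->
  forall x y, f y - f x <= (K + 2 * w) * `|y - x|.
Proof.
move=> K0 w0 fK fw x y; set n := `|y - x|.
have n_ge0 : 0 <= n := normr_ge0 _.
have Kw0 : 0 <= K + 2 * w by rewrite addr_ge0// mulr_ge0.
have [->|yx] := eqVneq y x; first by rewrite subrr mulr_ge0.
have n0 : 0 < n by rewrite normr_gt0 subr_eq0.
have fyx : f y - f x <= K by rewrite (le_trans (ler_norm _)).
have [n1|n1] := leP 1 n.
  rewrite (le_trans fyx)// -[leLHS]mulr1 ler_pM// lerDl mulr_ge0//.
pose e := n^-1 *: (y - x).
have e1 : `|e| = 1 by rewrite normrZ normfV normr_id mulVf// gt_eqF.
have ne : n *: e = y - x by rewrite scalerA divff ?gt_eqF// scale1r.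
(* The segment from [x - e] to [y] has length [1 + n], and [x] lies at distance 1 from its first
   end; this weight makes [x] the convex combination. *)
pose lam := (1 + n)^-1.
have lam01 : 0 <= lam <= 1.
  have n1_gt0 : 0 < 1 + n by rewrite addr_gt0.
  by rewrite invr_ge0 (ltW n1_gt0)/= invf_le1// lerDl.
have onem : 1 - lam = lam * n by rewrite /lam; field; rewrite gt_eqF// addr_gt0.
have := fw lam y (x - e) lam01.
have -> : lam *: y + (1 - lam) *: (x - e) = x.
  rewrite onem -scalerA -scalerDr scalerBr ne opprB addrCA addrA.
  have -> : n *: x + y + (x - y) = (1 + n) *: x.
    by rewrite -addrA [y + _]addrC subrK addrC scalerDl scale1r.
  by rewrite scalerA mulVf ?scale1r// gt_eqF// addr_gt0.
have -> : `|y - (x - e)| = 1 + n.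
  rewrite opprB addrCA -ne -[X in X + _]scale1r -scalerDl normrZ e1 mulr1.
  by rewrite ger0_norm// addr_ge0// ltW.
rewrite onem.
have -> : w * lam * (lam * n) * (1 + n) ^+ 2 = w * n.
  by rewrite /lam; field; rewrite gt_eqF// addr_gt0.
have -> : lam * f y + lam * n * f (x - e) - f x =
    lam * (f y - f x + n * (f (x - e) - f x)).
  by rewrite /lam; field; rewrite gt_eqF// addr_gt0.
rewrite ler_pdivrMl ?addr_gt0// => H.
have h1 : n * (f x - f (x - e)) <= n * K.
  by rewrite ler_wpM2l// (le_trans (ler_norm _)).
have h2 : n * (w * n) <= 1 * (w * n) by rewrite ler_wpM2r ?mulr_ge0// ltW.
lra.
Qed.

End semiconcave_lipschitz.

Section taylor.
Context {R : realType}.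

Lemma is_derive_line (V : normedModType R) (f : V -> R) (z v : V) (s : R) :
  derivable f (z + s *: v) v ->
  is_derive s 1 (fun r => f (z + r *: v)) ('D_v f (z + s *: v)).
Proof.
have E : (fun h : R => h^-1 *: (f (z + (h *: 1 + s) *: v) - f (z + s *: v))) =
         (fun h => h^-1 *: (f (h *: v + (z + s *: v)) - f (z + s *: v))).
  apply/funext => h; congr (_ *: (f _ - _)).
  by rewrite scalerDl -scalerA scale1r addrCA.
by move=> df; split; rewrite /derivable /derive /= ?E.
Qed.

(** The mean value theorem twice: for f', and then for f minus the quadratic polynomial, whose
    derivative is nonnegative on ]0, 1[. *)
Lemma taylor2_lower (f f' f'' : R -> R) (m : R) :
  (forall s : R, is_derive s 1 f (f' s)) -> (forall s : R, is_derive s 1 f' (f'' s)) ->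
  (forall s, m <= f'' s) -> f 0 + f' 0 + m / 2 <= f 1.
Proof.
move=> df df' fm.
have cont (g g' : R -> R) a b : (forall s : R, is_derive s 1 g (g' s)) ->
    {within `[a, b], continuous g}.
  move=> dg; apply: continuous_subspaceT => s.
  by apply/differentiable_continuous/derivable1_diffP; have [] := dg s.
have f'_ge s : 0 < s -> f' 0 + m * s <= f' s.
  move=> s0; have [r _] := @MVT R f' f'' _ _ s0 (fun r _ => df' r) (cont _ _ _ _ df').
  by rewrite subr0 => /eqP; rewrite subr_eq addrC => /eqP ->; rewrite lerD2l ler_wpM2r// ltW.
pose g s := f s - (f' 0 * s + m / 2 * s ^+ 2).
have dg (s : R) : is_derive s 1 g (f' s - (f' 0 + m * s)).
  have -> : g = f - ((f' 0) \*: (@id R) + (m / 2) \*: ((@id R) ^+ 2)).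
    by apply/funext => r.
  have := df s => dfs; apply: is_derive_eq.
  by rewrite /GRing.scale/= expr1; field.
have [r r01] := @MVT R g _ _ _ (@ltr01 R) (fun r _ => dg r) (cont _ _ _ _ dg).
have := f'_ge r _.
rewrite /g subr0 mulr1 expr1n expr0n/= !mulr0 mulr1 addr0 subr0.
move: r01; rewrite in_itv/= => /andP[r0 _] /(_ r0).
lra.
Qed.

Lemma taylor2_upper (f f' f'' : R -> R) (m : R) :
  (forall s : R, is_derive s 1 f (f' s)) -> (forall s : R, is_derive s 1 f' (f'' s)) ->
  (forall s, f'' s <= m) -> f 1 <= f 0 + f' 0 + m / 2.
Proof.
move=> df df' fm.
have := @taylor2_lower (- f) (- f') (- f'') (- m) (fun s => is_deriveN (df s))
  (fun s => is_deriveN (df' s)).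
have H s : - m <= (- f'') s by rewrite lerN2.
by move=> /(_ H); rewrite !fctE/=; lra.
Qed.

End taylor.

Section coercivity.
Context {R : realType} {d k : nat}.
Local Notation V := ('cV[R]_d * 'cV[R]_k)%type.
Implicit Types (f : V -> R) (u : 'cV[R]_k).

Lemma diru_decomposition u : (0, u) = \sum_j u j 0 *: @diru R d k j :> V.
Proof.
have -> : \sum_j u j 0 *: @diru R d k j =
    (\sum_j u j 0 *: (@diru R d k j).1, \sum_j u j 0 *: (@diru R d k j).2).
  elim: (index_enum _) => [|j r IH]; first by rewrite !big_nil.
  by rewrite !big_cons IH.
congr (_, _) => /=; first by rewrite big1// => j _; rewrite scaler0.
rewrite [LHS]matrix_sum_delta; apply: eq_bigr => j _.
by rewrite big_ord1.
Qed.

Lemma derive_control_direction f z u : differentiable f z ->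
  'D_((0, u) : V) f z = \sum_j u j 0 * 'D_(diru j) f z.
Proof.
move=> df; rewrite deriveE// diru_decomposition linear_sum; apply: eq_bigr => j _.
by rewrite linearZ /= deriveE.
Qed.

Lemma derive2_control_direction f z u : C2 f ->
  'D_((0, u) : V) ('D_((0, u) : V) f) z = qform (hess_uu f z) u.
Proof.
move=> [[df _] d2f].
have [d2fu _] := d2f (0, u).
rewrite derive_control_direction//.
have E : 'D_((0, u) : V) f = \sum_j (u j 0 \*: 'D_(diru j) f).
  apply/funext => y; rewrite derive_control_direction// fct_sumE.
  by apply: eq_bigr.
rewrite /qform mxE.
under [RHS]eq_bigr do rewrite mxE mulr_suml.
rewrite exchange_big /=; apply: eq_bigr => i _.
rewrite E derive_sum => [|j]; last first.
  by apply: derivableZ; apply: diff_derivable; have [] := d2f (diru j).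
rewrite mulr_sumr; apply: eq_bigr => j _.
rewrite deriveZ; last by apply: diff_derivable; have [] := d2f (diru j).
by rewrite !mxE /GRing.scale/=; ring.
Qed.

(** Taylor expansion at order two along the ray s -> (x, s u). The quadratic term is at least |u|^2
    / (2 c0); half of it absorbs the linear term by Young's inequality, which leaves 1 / (4 c0). *)
Lemma control_growth f (c0 c2 : R) : 0 < c0 -> 0 <= c2 -> C2 f ->
  (forall x u v, c0^-1 * enorm v ^+ 2 <= qform (hess_uu f (x, u)) v
                 <= c0 * enorm v ^+ 2) ->
  (forall x, `|f (x, 0)| <= c2 /\ enorm (gradu f (x, 0)) <= c2) ->
  forall x u, (4 * c0)^-1 * `|u| ^+ 2 - (c2 + c0 * (k%:R * c2) ^+ 2) <= f (x, u)
              <= (c2 + k%:R * c2 + c0 * k.+1%:R ^+ 2) * (1 + `|u| ^+ 2).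
Proof.
move=> c0_gt0 c2_ge0 f2 hess f0 x u.
have [[df _] d2f] := f2; have [d2fu _] := d2f (0, u).
pose z s : V := (x, 0) + s *: (0, u).
have zE s : z s = (x, s *: u).
  by rewrite /z; congr (_, _) => /=; rewrite ?scaler0 ?addr0 ?add0r.
have [fx0 gx0] := f0 x.
set E := enorm u ^+ 2; set n := `|u|.
have n0 : 0 <= n := normr_ge0 _.
have nE : n ^+ 2 <= E by rewrite lerXn2r ?nnegrE ?enorm_ge0// normr_le_enorm.
have En : E <= k.+1%:R ^+ 2 * n ^+ 2.
  by rewrite -exprMn lerXn2r ?nnegrE ?enorm_ge0 ?mulr_ge0// enorm_le_normr.
pose p s := f (z s); pose p' s := 'D_((0, u) : V) f (z s).
pose p'' s := 'D_((0, u) : V) ('D_((0, u) : V) f) (z s).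
have dp (s : R) : is_derive s 1 p (p' s).
  by apply: is_derive_line; exact/diff_derivable.
have dp' (s : R) : is_derive s 1 p' (p'' s).
  by apply: is_derive_line; exact/diff_derivable.
have p''E s : p'' s = qform (hess_uu f (x, s *: u)) u.
  by rewrite -zE; exact: (derive2_control_direction (z s) u f2).
have lo : p 0 + p' 0 + c0^-1 * E / 2 <= p 1.
  by apply: taylor2_lower dp dp' _ => s; rewrite p''E; case/andP: (hess x (s *: u) u).
have hi : p 1 <= p 0 + p' 0 + c0 * E / 2.
  by apply: taylor2_upper dp dp' _ => s; rewrite p''E; case/andP: (hess x (s *: u) u).
have p0E : p 0 = f (x, 0) by rewrite /p zE scale0r.
have p1E : p 1 = f (x, u) by rewrite /p zE scale1r.
have p'0 : `|p' 0| <= k%:R * c2 * n.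
  rewrite /p' zE scale0r derive_control_direction//.
  apply: le_trans (ler_norm_sum _ _ _) _.
  apply: (@le_trans _ _ (\sum_(j < k) c2 * n)).
    apply: ler_sum => j _; rewrite normrM mulrC; apply: ler_pM => //.
      apply: le_trans gx0; apply: le_trans (normr_le_enorm _).
      by have := normr_coord_le (gradu f (x, 0)) j; rewrite mxE.
    exact: normr_coord_le.
  by rewrite sumr_const card_ord -[leLHS]mulr_natl mulrA.
rewrite -p1E; move: lo hi fx0 p'0; rewrite -p0E !ler_norml.
move=> lo hi /andP[f1 f2'] /andP[g1 g2].
set a := k%:R * c2 in g1 g2 *.
have a0 : 0 <= a by rewrite mulr_ge0.
have ci : 0 < c0^-1 by rewrite invr_gt0.
apply/andP; split.
  have -> : (4 * c0)^-1 * n ^+ 2 = c0^-1 * n ^+ 2 / 4 by field; rewrite gt_eqF.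
  have h1 : c0^-1 * n ^+ 2 <= c0^-1 * E by rewrite ler_wpM2l// ltW.
  have h2 : a * n <= c0^-1 * n ^+ 2 / 4 + c0 * a ^+ 2.
    have -> : c0^-1 * n ^+ 2 / 4 + c0 * a ^+ 2 =
        a * n + c0 * (c0^-1 * n / 2 - a) ^+ 2 by field; rewrite gt_eqF.
    by rewrite lerDl mulr_ge0 ?sqr_ge0// ltW.
  lra.
have h1 : c0 * E <= c0 * k.+1%:R ^+ 2 * n ^+ 2 by rewrite -mulrA ler_wpM2l// ltW.
have h2 : a * n <= a * (1 + n ^+ 2).
  by rewrite ler_wpM2l//; have := sqr_ge0 (n - 1); nra.
have h3 : 0 <= c2 * n ^+ 2 by rewrite mulr_ge0// sqr_ge0.
have h4 : 0 <= c0 * k.+1%:R ^+ 2 by rewrite mulr_ge0 ?sqr_ge0// ltW.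
have h5 : 0 <= c0 * k.+1%:R ^+ 2 * n ^+ 2 by rewrite mulr_ge0// sqr_ge0.
lra.
Qed.

End coercivity.

(** * Regularity of the flow of measures *)

(* Measurability is not assumed: that of [deriv_norm2] is not available. *)
Lemma ge0_integral_mono d (X : measurableType d) (R : realType)
    (m : {measure set X -> \bar R}) (D : set X) (f h : X -> \bar R) :
  (forall x, D x -> 0 <= f x)%E -> (forall x, D x -> f x <= h x)%E ->
  (\int[m]_(x in D) f x <= \int[m]_(x in D) h x)%E.
Proof.
move=> f0 fh; have h0 x : D x -> (0 <= h x)%E by move=> Dx; rewrite (le_trans (f0 x Dx))// fh.
rewrite !ge0_integralE//; apply/ge_ereal_sup => _ [q /= qf <-].
apply: ereal_sup_ubound; exists q => //= x; apply: le_trans (qf x) _.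
by rewrite !patchE; case: ifPn => // /set_mem; exact: fh.
Qed.

Section velocity.
Context {R : realType} {d k : nat}.
Variables (A : 'M[R]_d) (B : 'M[R]_(d, k)).
Local Notation mu := (@lebesgue_measure R).
Local Notation traj := (trajectory A B).
Implicit Types (u : R -> 'cV[R]_k) (g : R -> 'cV[R]_d).

(** Integrate the nonnegative function (|f| - m)^2, where m is the mean of |f|. *)
Lemma cauchy_schwarz_itv (f : R -> R) a b : a < b ->
  mu.-integrable `[a, b] (EFin \o f) ->
  mu.-integrable `[a, b] (EFin \o (fun s => f s ^+ 2)) ->
  (\int[mu]_(s in `[a, b]) `|f s|) ^+ 2 <=
  (b - a) * \int[mu]_(s in `[a, b]) f s ^+ 2.
Proof.
move=> ab fi f2; have nf := integrable_norm fi.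
have ab0 : 0 < b - a by rewrite subr_gt0.
set X := \int[mu]_(s in `[a, b]) `|f s|; set Y := \int[mu]_(s in `[a, b]) f s ^+ 2.
pose m := X / (b - a).
have : 0 <= \int[mu]_(s in `[a, b]) ((f s ^+ 2 + m ^+ 2) - 2 * m * `|f s|).
  apply: Rintegral_ge0 => s _; rewrite -(real_normK (num_real (f s))).
  by have := sqr_ge0 (`|f s| - m); lra.
have i1 := integrable_itvD f2 (integrable_itv_cst a b (m ^+ 2)).
have i2 := integrable_itvZ (2 * m) nf.
rewrite RintegralB// RintegralD//; last exact: integrable_itv_cst.
have E3 : \int[mu]_(s in `[a, b]) (2 * m * `|f s|) = 2 * m * X by rewrite RintegralZl.
rewrite (Rintegral_itv_cst (m ^+ 2) (ltW ab)) -/Y.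
move: E3; set Z := \int[mu]_(s in _) (2 * m * _) => E3.
rewrite [X in _ - X](E3 : _ = _) => H.
have E : m * (b - a) = X by rewrite /m divfK// gt_eqF.
have : m ^+ 2 * (b - a) = m * X by rewrite expr2 -mulrA E.
move=> E2; rewrite E2 in H.
have : m * X <= Y by lra.
by rewrite -(ler_pM2l ab0) mulrA [_ * m]mulrC E -expr2.
Qed.

(** Lebesgue differentiation of the integral equation, one coordinate at a time; finitely many null
    sets are then discarded together. *)
Lemma derive_trajectory_ae T x u g : 0 < T -> integrable_control 0 T u ->
  traj 0 T x u g ->
  {ae mu, forall s, 0 < s < T -> 'D_1 g s = A *m g s + B *m u s}.
Proof.
move=> T0 iu [cg gE].
pose f i s := (A *m g s + B *m u s) i 0.
have fi i : mu.-integrable `[0, T] (EFin \o f i) by exact: integrable_velocity.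
have ae_i i : {ae mu, forall s, 0 < s < T ->
    is_derive s 1 (fun r => g r i 0) (f i s)}.
  (* Extension by zero makes the velocity integrable on the line; near an interior point its
     primitive is still the coordinate of [g] up to a constant. *)
  pose fT := f i \_ `[0, T].
  have ifT (D : set R) : measurable D -> mu.-integrable D (EFin \o fT).
    move=> mD; apply: (@integrableS _ _ _ _ setT) => //.
    have [+ _] := @integrable_mkcond _ _ _ mu `[0, T]%classic (EFin \o f i) (measurable_itv _).
    by rewrite restrict_EFin; apply.
  have := @FTC1 R fT (BLeft 0) (fun y => ifT _ (measurable_itv _))
    (integrable_locally (measurable_itv _) (fi i)).
  apply: (@filterS _ _ (ae_filter_ringOfSetsType mu)) => s H /andP[s0 sT].
  have H0 : ((0 : R)%:E < (s : R)%:E)%E by rewrite lte_fin.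
  have [] := H H0.
  set P := fun y => _; rewrite derive1E => dP D1P.
  have fTs : fT s = f i s by rewrite /fT patchE mem_set//= in_itv/= !ltW.
  have PE : is_derive s 1 (cst (x i 0) + P) (f i s).
    by rewrite -fTs -[fT s]add0r; apply: is_deriveD; split.
  apply: near_eq_is_derive PE.
  have : s \in `]0, T[ by rewrite in_itv/= s0.
  move=> /near_in_itvoo; apply: filterS => r /[!in_itv]/= /andP[r0 rT].
  rewrite gE; last by rewrite in_itv/= !ltW.
  rewrite mxE [X in _ = _ + X]mxE; congr (_ + _).
  apply: eq_Rintegral => q /set_mem/=; rewrite in_itv/= => /andP[q0 qr].
  by rewrite /fT patchE mem_set//= in_itv/= q0 (le_trans qr)// ltW.
have : {ae mu, forall s, forall i, 0 < s < T -> is_derive s 1 (fun r => g r i 0) (f i s)}.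
  exact: (@filter_forall _ _ _ _ (ae_filter_ringOfSetsType mu) ae_i).
apply: (@filterS _ _ (ae_filter_ringOfSetsType mu)) => s H s0T; apply/colP => i.
have dg : derivable g s 1.
  apply/derivable_mxP => j l; rewrite (ord1 l).
  by have [] := H j s0T.
rewrite derive_mx// mxE.
by have := H i s0T => ?; rewrite derive_val.
Qed.

(** The exceptional null set is removed on the left, where the integrand is measurable; monotonicity
    then asks nothing of the measurability of ['D_1 g]. *)
Lemma velocity_square_integral T x u g : 0 < T -> integrable_control 0 T u ->
  traj 0 T x u g ->
  (\int[mu]_(s in `[0%R, T]) (enorm (A *m g s + B *m u s) ^+ 2)%:E <=
   \int[mu]_(s in `[0%R, T]) (enorm ('D_1 g s) ^+ 2)%:E)%E.
Proof.
move=> T0 iu tg; have [cg _] := tg.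
have [N [mN N0 sub]] := derive_trajectory_ae T0 iu tg.
pose v s := enorm (A *m g s + B *m u s) ^+ 2.
have mv : measurable_fun `[0, T] v.
  apply: measurable_funX; apply: measurable_enorm => // i.
  by have /integrableP[/measurable_EFinP] := integrable_velocity A B i cg iu.
(* The end points are added because the derivative is two-sided and the equation holds only on
   [0, T]. *)
pose N' := N `|` [set 0; T].
have mN' : measurable N' by apply: measurableU => //; apply: measurableU.
have N'0 : mu N' = 0%E.
  apply/eqP; rewrite -measure_le0; apply: le_trans (measureU2 _ _ _) _ => //.
    exact: measurableU.
  rewrite [X in (X + _)%E](N0 : mu N = 0%E) add0e.
  by rewrite [leLHS](countable_lebesgue_measure0 (finite_set_countable (finite_set2 _ _))).
have v0 s : `[0, T]%classic s -> (0 <= (v s)%:E)%E by rewrite lee_fin sqr_ge0.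
have -> := @ge0_negligible_integral _ _ _ mu `[0, T]%classic N' (EFin \o v) mN'
  (measurable_itv _) ((measurable_EFinP _ _).2 mv) v0 N'0.
rewrite integral_mkcond [leRHS]integral_mkcond; apply: ge0_integral_mono.
  by move=> s _; rewrite patchE; case: ifPn => // _; rewrite lee_fin sqr_ge0.
move=> s _; rewrite !patchE; case: ifPn => [/set_mem[s0T Ns]|_].
  rewrite mem_set//; suff -> : 'D_1 g s = A *m g s + B *m u s by [].
  apply: contrapT => ns; apply: (Ns); left; apply: sub => /= H; apply: ns; apply: H.
  move: s0T; rewrite /= in_itv/= => /andP[s0 sT].
  rewrite !lt_neqAle s0 sT !andbT; apply/andP; split; apply/eqP => E; apply: (Ns).
    by right; left.
  by right; right.
by case: ifPn => // _; rewrite lee_fin sqr_ge0.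
Qed.

Lemma trajectory_increment T x u g (Q : R) : 0 < T -> integrable_control 0 T u ->
  traj 0 T x u g ->
  (\int[mu]_(s in `[0%R, T]) (enorm ('D_1 g s) ^+ 2)%:E <= Q%:E)%E ->
  forall s t, 0 <= s -> s < t -> t <= T ->
  `|g t - g s| <= Num.sqrt (t - s) * Num.sqrt Q.
Proof.
move=> T0 iu tg IQ s t s0 st tT; have [cg gE] := tg.
have vQ := le_trans (velocity_square_integral T0 iu tg) IQ.
have ts0 : 0 <= t - s by rewrite subr_ge0 ltW.
have Q0 : 0 <= Q.
  rewrite -lee_fin; apply: le_trans IQ; apply: integral_ge0 => r _.
  by rewrite lee_fin sqr_ge0.
apply: normr_cV_le => [|i]; first by rewrite mulr_ge0// sqrtr_ge0.
pose f r := (A *m g r + B *m u r) i 0.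
have f0T : mu.-integrable `[0, T] (EFin \o f) by exact: integrable_velocity.
have fst : mu.-integrable `[s, t] (EFin \o f) by exact: integrable_itvS f0T.
have mf : measurable_fun `[s, t] f by have /integrableP[/measurable_EFinP] := fst.
have f2 : (\int[mu]_(r in `[s, t]) (f r ^+ 2)%:E <= Q%:E)%E.
  apply: le_trans vQ; rewrite integral_mkcond [leRHS]integral_mkcond.
  apply: ge0_integral_mono => r _; rewrite !patchE; case: ifPn => [/set_mem|_].
  - by rewrite lee_fin sqr_ge0.
  - by [].
  - rewrite /= in_itv/= => /andP[sr rt].
    rewrite mem_set/=; last by rewrite in_itv/= (le_trans s0 sr) (le_trans rt).
    rewrite lee_fin -(real_normK (num_real (f r))) lerXn2r ?nnegrE ?enorm_ge0//.
    by rewrite (le_trans (normr_coord_le _ _))// normr_le_enorm.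
  - by case: ifPn => // _; rewrite lee_fin sqr_ge0.
have f2i : mu.-integrable `[s, t] (EFin \o (fun r => f r ^+ 2)).
  apply/integrableP; split; first exact/measurable_EFinP/measurable_funX.
  under eq_integral do rewrite /= ger0_norm ?sqr_ge0//.
  by apply: le_lt_trans f2 _; rewrite ltry.
have f2Q : \int[mu]_(r in `[s, t]) f r ^+ 2 <= Q.
  by rewrite -lee_fin /Rintegral fineK//; exact: integrable_fin_num.
have -> : (g t - g s) i 0 = \int[mu]_(r in `[s, t]) f r.
  rewrite mxE [X in _ + X]mxE !gE ?in_itv/=; [|lra..].
  rewrite mxE [X in _ - X]mxE [X in _ + X - _]mxE [X in _ - (_ + X)]mxE.
  rewrite (@Rintegral_itv_split _ _ 0 s t)//; [|exact: ltW|exact: integrable_itvS f0T].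
  by rewrite /f; ring.
apply: le_trans (le_normr_Rintegral _ fst) _ => //.
rewrite -sqrtrM// -[leLHS]ger0_norm; last exact: Rintegral_ge0.
rewrite -sqrtr_sqr ler_wsqrtr//.
apply: le_trans (cauchy_schwarz_itv st fst f2i) _.
by rewrite ler_wpM2l.
Qed.

End velocity.

Section flow_regularity.
Context {R : realType} {d k : nat}.
Variables (A : 'M[R]_d) (B : 'M[R]_(d, k)) (T : R).
Local Notation mu := (@lebesgue_measure R).
Local Notation P := (probability (borel 'cV[R]_d) R).
Local Notation C := (borel (curve A B T)).
Local Notation ev := (@Defs.eval R d k A B T).
Hypothesis T_gt0 : 0 < T.

(** The quotient form isolates [deriv_norm2], so that the inequality remains meaningful when it is
    infinite and can be raised to the power [alpha]. *)
Lemma curve_increment (g : curve A B T) s t : 0 <= s -> s < t -> t <= T ->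
  ((`|(\val g : R -> 'cV[R]_d) t - (\val g : R -> 'cV[R]_d) s| / Num.sqrt (t - s))%:E
    <= deriv_norm2 g)%E.
Proof.
move=> s0 st tT; rewrite /deriv_norm2.
have [_ [x [u [Lu tg]]]] := set_mem (valP g).
have iu : integrable_control 0 T u by exact: Lp_control_integrable Lu.
set I := (\int[mu]_(_ in _) _)%E.
have I0 : (0 <= I)%E by apply: integral_ge0 => r _; rewrite lee_fin sqr_ge0.
have := trajectory_increment T_gt0 iu tg; rewrite -/I.
case: I I0 => [Q Q0 H| _ _|//]; last by rewrite poweRyr ?leey// mul1r invr_neq0.
rewrite poweR_EFin lee_fin mul1r powR12_sqrt//.
rewrite ler_pdivrMr ?sqrtr_gt0 ?subr_gt0// mulrC.
exact: H.
Qed.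

Lemma measurable_continuous_borel (X : ptopologicalType) (f : X -> R) :
  continuous f -> measurable_fun setT (f : borel X -> R).
Proof.
move=> /continuousP cf; apply: (measurability _ (RGenOpens.measurableE R)).
move=> _ [_ [a [b ->] <-]]; rewrite setTI; apply: sub_sigma_algebra.
exact/cf/interval_open.
Qed.

Lemma measurable_borel_coord n (i : 'I_n) :
  measurable_fun setT (fun x : borel 'cV[R]_n => (x : 'cV[R]_n) i 0).
Proof. by apply: measurable_continuous_borel; exact: coord_continuous. Qed.

Lemma measurable_borel_enorm n :
  measurable_fun setT (fun x : borel 'cV[R]_n => enorm (x : 'cV[R]_n)).
Proof.
apply: (@measurableT_comp _ _ _ _ _ _ (@Num.sqrt R)).
  by apply: continuous_measurable_fun; exact: sqrt_continuous.
by apply: measurable_sum => j; apply: measurable_funX; exact: measurable_borel_coord.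
Qed.

Lemma measurable_borel_enormB n : measurable_fun setT
  (fun z : (borel 'cV[R]_n * borel 'cV[R]_n)%type => enorm ((z.1 : 'cV[R]_n) - z.2)).
Proof.
apply: (@measurableT_comp _ _ _ _ _ _ (@Num.sqrt R)).
  by apply: continuous_measurable_fun; exact: sqrt_continuous.
apply: measurable_sum => j; apply: measurable_funX.
have -> : (fun z : (borel 'cV[R]_n * borel 'cV[R]_n)%type => ((z.1 : 'cV[R]_n) - z.2) j 0) =
    (fun z : (borel 'cV[R]_n * borel 'cV[R]_n)%type =>
      (z.1 : 'cV[R]_n) j 0 - (z.2 : 'cV[R]_n) j 0).
  by apply/funext => z; rewrite !mxE.
apply: measurable_funB.
- exact: (measurableT_comp (measurable_borel_coord j) measurable_fst).
- exact: (measurableT_comp (measurable_borel_coord j) measurable_snd).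
Qed.

Lemma measurable_eval_normB s t : measurable_fun setT
  (fun g : C => enorm ((ev s g : 'cV[R]_d) - ev t g)).
Proof.
apply: (measurableT_comp (@measurable_borel_enormB d) (g := fun g : C => (ev s g, ev t g))).
by apply: measurable_fun_pair; exact: measurable_eval.
Qed.

Variables (alpha : R) (m0 : P) (r : R) (eta : probability C R).
Hypothesis alpha_gt1 : 1 < alpha.
Hypothesis m0_alpha : finite_moment alpha m0.
Hypothesis etaP : curve_measures alpha m0 r eta.

(** The increment divided by the square root of t - s is at most (d + 1) times the L^2 norm of the
    velocity, whose [alpha]-th moment is at most [r]. Bounding v by 1 + v^alpha makes the mean at
    most 1 + r before rescaling. *)
Lemma mean_increment s t : 0 <= s -> s < t -> t <= T ->
  (\int[eta]_g (enorm ((ev s g : 'cV[R]_d) - ev t g))%:E <=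
   (d.+1%:R * (1 + r) * Num.sqrt (t - s))%:E)%E.
Proof.
move=> s0 st tT.
have alpha0 : 0 < alpha by rewrite (lt_trans _ alpha_gt1).
set e := Num.sqrt (t - s).
have e0 : 0 < e by rewrite sqrtr_gt0 subr_gt0.
pose q (g : C) := enorm ((ev s g : 'cV[R]_d) - ev t g) / (d.+1%:R * e).
have de0 : 0 < d.+1%:R * e by rewrite mulr_gt0.
have q0 g : 0 <= q g by rewrite divr_ge0 ?enorm_ge0 ?ltW.
have mq : measurable_fun setT q.
  by apply: measurable_funM; [exact: measurable_eval_normB|exact: measurable_cst].
have qN g : ((q g)%:E <= deriv_norm2 g)%E.
  apply: le_trans (curve_increment g s0 st tT); rewrite lee_fin /q invfM mulrA ler_pM2r ?invr_gt0//.
  rewrite ler_pdivrMr// mulrC distrC.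
  exact: enorm_le_normr.
have mqa : measurable_fun setT (fun g => q g `^ alpha).
  exact: (measurableT_comp (measurable_powR alpha)).
have qa : (\int[eta]_g (q g `^ alpha)%:E <= r%:E)%E.
  case: etaP => + _; apply: le_trans; apply: ge0_integral_mono => g _.
    by rewrite lee_fin powR_ge0.
  rewrite -poweR_EFin; apply: gt0_ler_poweR (ltW alpha0) _ _ _ _ _ => //.
  - by rewrite in_itv/= lee_fin q0 leey.
  - rewrite in_itv/= leey andbT; exact: poweR_ge0.
have q1 : (\int[eta]_g (q g)%:E <= (1 + r)%:E)%E.
  apply: (@le_trans _ _ (\int[eta]_g (1 + q g `^ alpha)%:E)%E).
    apply: ge0_integral_mono => g _; first by rewrite lee_fin.
    by rewrite lee_fin; apply: le1D_powR => //; exact: ltW.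
  under eq_integral do rewrite EFinD.
  rewrite ge0_integralD//; last 2 first.
  - by move=> g _; rewrite lee_fin powR_ge0.
  - exact/measurable_EFinP.
  have -> : (\int[eta]_(g in setT) 1 = 1)%E by rewrite integral_cst// mul1e; exact: probability_setT.
  by rewrite EFinD leeD2l.
have -> : (fun g : C => (enorm ((ev s g : 'cV[R]_d) - ev t g))%:E) =
    (fun g => ((d.+1%:R * e)%:E * (q g)%:E)%E).
  by apply/funext => g; rewrite -EFinM /q mulrC divfK// gt_eqF.
rewrite ge0_integralZl_EFin//; last 3 first.
- by move=> g _; rewrite lee_fin.
- exact/measurable_EFinP.
- exact: ltW.
by rewrite mulrAC [leRHS]EFinM; apply: lee_wpmul2l => //; rewrite lee_fin ltW.
Qed.

(** The assumptions on L and G concern only measures with finite first moment. Here |g(t)| is at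
    most |g(0)|, controlled by the moment of [m0], plus the increment, controlled by
    [mean_increment]. *)
Lemma flow_moment t : 0 <= t <= T -> finite_moment 1 (flow eta t).
Proof.
move=> /andP[t0 tT]; rewrite /finite_moment /= /moment.
have alpha0 : 0 < alpha by rewrite (lt_trans _ alpha_gt1).
under eq_integral do rewrite powRr1 ?enorm_ge0//.
have mE (p : R) : measurable_fun setT (fun x : borel 'cV[R]_d => enorm (x : 'cV[R]_d) `^ p).
  exact: (measurableT_comp (measurable_powR p) (@measurable_borel_enorm d)).
rewrite ge0_integral_distribution//; last 2 first.
- by apply/measurable_EFinP; exact: measurable_borel_enorm.
- by move=> x; rewrite lee_fin enorm_ge0.
pose c : R := d.+1%:R.
have start : (\int[eta]_g (enorm (ev 0 g : 'cV[R]_d) `^ alpha)%:E < +oo)%E.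
  move: (m0_alpha); rewrite /finite_moment /= /moment.
  rewrite (@eq_measure_integral _ _ _ _ (flow eta 0)); last first.
    by move=> E mE' _; case: etaP => _ H; exact/esym/H.
  rewrite ge0_integral_distribution//; first exact/measurable_EFinP.
  by move=> x; rewrite lee_fin powR_ge0.
have m0' : measurable_fun setT (fun g : C => enorm (ev 0 g : 'cV[R]_d) `^ alpha).
  exact: (measurableT_comp (mE alpha) (measurable_eval 0)).
have inc : (\int[eta]_g (enorm ((ev 0 g : 'cV[R]_d) - ev t g))%:E < +oo)%E.
  move: t0; rewrite le_eqVlt => /predU1P[<-|t_gt0]; last first.
    by apply: le_lt_trans (mean_increment (lexx 0) t_gt0 tT) _; rewrite ltry.
  under eq_integral do rewrite subrr enorm0.
  by rewrite integral0.
apply: (@le_lt_trans _ _ (\int[eta]_g ((c * (1 + enorm (ev 0 g : 'cV[R]_d) `^ alpha))%:E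
    + (c * enorm ((ev 0 g : 'cV[R]_d) - ev t g))%:E))%E).
  apply: ge0_integral_mono => g _ /=; first by rewrite lee_fin enorm_ge0.
  rewrite lee_fin -mulrDr; apply: le_trans (enorm_le_normr _) _; rewrite ler_wpM2l//.
  rewrite -[X in `|X|](subKr (ev 0 g : 'cV[R]_d)).
  apply: le_trans (ler_normB _ _) _; apply: lerD; last exact: normr_le_enorm.
  apply: le_trans (normr_le_enorm _) _.
  by apply: le1D_powR; [exact: enorm_ge0|exact: ltW].
have mB := measurable_eval_normB 0 t.
rewrite ge0_integralD//; last 4 first.
- by move=> g _; rewrite lee_fin mulr_ge0// addr_ge0// powR_ge0.
- by apply/measurable_EFinP; apply: measurable_funM => //; exact: measurable_funD.
- by move=> g _; rewrite lee_fin mulr_ge0// enorm_ge0.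
- by apply/measurable_EFinP; exact: measurable_funM.
apply: lte_add_pinfty.
- under eq_integral do rewrite EFinM.
  rewrite ge0_integralZl_EFin//; last 2 first.
  + by move=> g _; rewrite lee_fin addr_ge0// powR_ge0.
  + by apply/measurable_EFinP; exact: measurable_funD.
  apply: lte_mul_pinfty => //; first by rewrite lee_fin.
  under eq_integral do rewrite EFinD.
  rewrite ge0_integralD//; last 2 first.
  + by move=> g _; rewrite lee_fin powR_ge0.
  + exact/measurable_EFinP.
  have -> : (\int[eta]_(g in setT) 1 = 1)%E by rewrite integral_cst// mul1e; exact: probability_setT.
  by apply: lte_add_pinfty => //; rewrite ltry.
- under eq_integral do rewrite EFinM.
  rewrite ge0_integralZl_EFin//; last 2 first.
  + by move=> g _; rewrite lee_fin enorm_ge0.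
  + exact/measurable_EFinP.
  by apply: lte_mul_pinfty => //; rewrite lee_fin.
Qed.

Definition eval_pair (s t : R) (g : C) : (borel 'cV[R]_d * borel 'cV[R]_d)%type :=
  (ev s g, ev t g).

Lemma measurable_eval_pair s t : measurable_fun setT (eval_pair s t).
Proof. by apply: measurable_fun_pair; exact: measurable_eval. Qed.

HB.instance Definition _ s t :=
  isMeasurableFun.Build _ _ C _ (eval_pair s t) (measurable_eval_pair s t).

(** The joint law of (g(s), g(t)) under [eta] is a coupling of the two marginals, with transport
    cost the mean increment. *)
Lemma flow_d1 s t : 0 <= s <= T -> 0 <= t <= T ->
  (d1 (flow eta s) (flow eta t) <=
   (d.+1%:R * (1 + r) * Num.sqrt `|s - t|)%:E)%E.
Proof.
have d1_le a b : (d1 (flow eta a) (flow eta b) <=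
    \int[eta]_g (enorm ((ev a g : 'cV[R]_d) - ev b g))%:E)%E.
  apply: ereal_inf_lbound; exists (distribution eta (eval_pair a b)).
    move=> E mE; split; rewrite /distribution/= /pushforward /eval_pair.
    - by congr (eta _); apply/seteqP; split => g //= [].
    - by congr (eta _); apply/seteqP; split => g //= [].
  rewrite ge0_integral_distribution//.
  - by apply/measurable_EFinP; exact: measurable_borel_enormB.
  - by move=> z; rewrite lee_fin enorm_ge0.
move=> /andP[s0 sT] /andP[t0 tT]; apply: le_trans (d1_le s t) _.
have [st|ts|->] := ltgtP s t.
- by rewrite distrC ger0_norm ?subr_ge0 ?(ltW st)//; exact: mean_increment.
- under eq_integral do rewrite -enormN opprB.
  by rewrite ger0_norm ?subr_ge0 ?(ltW ts)//; exact: mean_increment.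
- under eq_integral do rewrite subrr enorm0.
  by rewrite integral0 subrr normr0 sqrtr0 mulr0.
Qed.

End flow_regularity.

(** * The mean field game *)

Lemma powR_three_halves (R : realType) (e : R) : 0 <= e -> e * Num.sqrt e = e `^ (3 / 2).
Proof.
move=> e0; have -> : 3 / 2 = 1 + 2^-1 :> R by lra.
rewrite powRD; first by rewrite powRr1// powR12_sqrt.
by rewrite paddr_eq0// oner_eq0.
Qed.

Section data_bounds.
Context {R : realType} {d k : nat}.
Local Notation P := (probability (borel 'cV[R]_d) R).
Variables (L : 'cV[R]_d -> 'cV[R]_k -> P -> R) (G : 'cV[R]_d -> P -> R).
Variables (wL wG : R) (m : P).
Hypothesis wL_ge0 : 0 <= wL.
Hypothesis wG_ge0 : 0 <= wG.
Hypothesis LG_semiconcave : semiconcave_data L G wL wG.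
Hypothesis m_moment : finite_moment 1 m.
Local Notation D := (d.+1%:R ^+ 2 : R).

Lemma semiconcave_norm u lam (x0 x1 : 'cV[R]_d) : 0 <= lam <= 1 ->
  lam * L x0 u m + (1 - lam) * L x1 u m - L (lam *: x0 + (1 - lam) *: x1) u m
    <= wL * D * lam * (1 - lam) * `|x0 - x1| ^+ 2 /\
  lam * G x0 m + (1 - lam) * G x1 m - G (lam *: x0 + (1 - lam) *: x1) m
    <= wG * D * lam * (1 - lam) * `|x0 - x1| ^+ 2.
Proof.
move=> lam01; have /andP[l0 l1] := lam01.
have e0 := enorm_ge0 x0; have e1 := enorm_ge0 x1.
(* The semiconcavity constants do not depend on the radius, so any ball containing both points will
   do. *)
pose q := enorm x0 + enorm x1 + 1.
have q_gt0 : 0 < q by rewrite /q; lra.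
have q0 : enorm x0 < q by rewrite /q; lra.
have q1 : enorm x1 < q by rewrite /q; lra.
have [h1 h2] := LG_semiconcave u lam01 q_gt0 q0 q1 m_moment.
have E : enorm (x0 - x1) ^+ 2 <= D * `|x0 - x1| ^+ 2.
  by rewrite -exprMn lerXn2r ?nnegrE ?enorm_ge0 ?mulr_ge0// enorm_le_normr.
have H w : 0 <= w -> w * lam * (1 - lam) * enorm (x0 - x1) ^+ 2 <=
    w * D * lam * (1 - lam) * `|x0 - x1| ^+ 2.
  move=> w0; have -> : w * D * lam * (1 - lam) * `|x0 - x1| ^+ 2 =
    w * lam * (1 - lam) * (D * `|x0 - x1| ^+ 2) by ring.
  by rewrite ler_wpM2l// !mulr_ge0// subr_ge0.
by split; [apply: le_trans h1 (H _ wL_ge0)|apply: le_trans h2 (H _ wG_ge0)].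
Qed.

Lemma semiconcave_midpoint u (x z : 'cV[R]_d) :
  L (x + z) u m + L (x - z) u m - 2 * L x u m <= 2 * (wL * D) * `|z| ^+ 2 /\
  G (x + z) m + G (x - z) m - 2 * G x m <= 2 * (wG * D) * `|z| ^+ 2.
Proof.
have h01 : 0 <= (1 / 2 : R) <= 1 by lra.
have [] := semiconcave_norm u (x + z) (x - z) h01.
have -> : (1 / 2) *: (x + z) + (1 - 1 / 2) *: (x - z) = x :> 'cV[R]_d.
  by apply/colP => i; rewrite !mxE; field.
have -> : `|x + z - (x - z)| = 2 * `|z|.
  rewrite (_ : x + z - (x - z) = 2 *: z) ?normrZ ?ger0_norm//.
  by apply/colP => i; rewrite !mxE; ring.
by rewrite exprMn => h1 h2; split; lra.
Qed.

End data_bounds.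

Theorem theorem5p2 (R : realType) (d k : nat)
  (T : R) (T_gt0 : 0 < T)
  (A : 'M[R]_d) (B : 'M[R]_(d, k))
  (L : 'cV[R]_d -> 'cV[R]_k -> probability (borel 'cV[R]_d) R -> R)
  (G : 'cV[R]_d -> probability (borel 'cV[R]_d) R -> R)
  (LG : standing_assumptions L G)
  (alpha : R) (alpha_gt1 : 1 < alpha)
  (m0 : probability (borel 'cV[R]_d) R) (m0_alpha : finite_moment alpha m0)
  (r0 : R) (r0P : invariance_threshold A B T L G alpha m0 r0)
  (r : R) (r0_le_r : r0 <= r)
  (eta : probability (borel (curve A B T)) R)
  (eta_mfg : mfg_equilibrium L G alpha m0 r eta)
  (LG_semiconcave : exists wL wG : R,
     [/\ 0 <= wL, 0 <= wG & semiconcave_data L G wL wG]) :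
  forall rho : R, 0 < rho -> exists2 Lambda : R, 0 <= Lambda &
    forall (t : R) (x : 'cV[R]_d) (h : 'cV[R]_d) (delta : R),
      0 <= t <= T -> enorm x <= rho ->
      0 <= t + delta <= T -> enorm (x + h) <= rho ->
      0 <= t - delta <= T -> enorm (x - h) <= rho ->
      value L G eta (t + delta) (x + h) + value L G eta (t - delta) (x - h)
        - 2 * value L G eta t x
        <= Lambda * (enorm h ^+ 2 + `|delta| `^ (3 / 2)).
Proof.
move=> rho rho_gt0.
have [etaP _] := eta_mfg; have [r0_gt0 _ _] := r0P.
have [wL [wG [wL0 wG0 LGw]]] := LG_semiconcave.
have [cL cL0 L_lip] := L_lipschitz LG.
have [cG' G_bd'] := G_bounded LG.
have [c0 [c1 [c2 [c0_gt0 _ c2_ge0 growth]]]] := L_growth LG.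
have P1 s : 0 <= s <= T -> finite_moment 1 (flow eta s).
  exact: (flow_moment T_gt0 alpha_gt1 m0_alpha etaP).
have TT : 0 <= T <= T by rewrite lexx ltW.
pose cG := `|cG'|; have cG0 : 0 <= cG := normr_ge0 _.
have G_bd x m : finite_moment 1 m -> `|G x m| <= cG.
  by move=> m1; apply: le_trans (G_bd' x m m1) (ler_norm _).
pose lo := c2 + c0 * (k%:R * c2) ^+ 2.
pose hi := c2 + k%:R * c2 + c0 * k.+1%:R ^+ 2.
have lo0 : 0 <= lo by rewrite addr_ge0// mulr_ge0 ?sqr_ge0// ltW.
have hi0 : 0 <= hi by rewrite !addr_ge0// mulr_ge0 ?sqr_ge0// ltW.
have L_bd x u m : finite_moment 1 m ->
    (4 * c0)^-1 * `|u| ^+ 2 - lo <= L x u m <= hi * (1 + `|u| ^+ 2).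
  move=> m1; apply: (@control_growth R d k (Lxu L m)) => //.
  - exact: L_C2 LG m m1.
  - by move=> y v w; have [+ _ _] := growth y v m m1; apply.
  - move=> y; have [_ _] := growth y 0 m m1.
    have := enorm_ge0 (gradx (Lxu L m) (y, 0)).
    have := enorm_ge0 (gradu (Lxu L m) (y, 0)).
    have := normr_ge0 (L y 0 m); rewrite /Lxu/= => h1 h2 h3 h4.
    by split; lra.
pose wL' := wL * d.+1%:R ^+ 2; pose wG' := wG * d.+1%:R ^+ 2.
have wL'0 : 0 <= wL' by rewrite mulr_ge0 ?sqr_ge0.
have wG'0 : 0 <= wG' by rewrite mulr_ge0 ?sqr_ge0.
pose K : R := d.+1%:R * (1 + r).
have K0 : 0 <= K by rewrite mulr_ge0//; lra.
have cK0 : 0 <= cL * K by rewrite mulr_ge0.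
(* One constant dominating every bound that the abstract control problem requires. *)
pose c := lo + hi + 2 * wL' + 2 * wG' + 2 * cG + cL * K.
have c_ge0 : 0 <= c by rewrite /c; lra.
pose F s x u := L x u (flow eta s).
have F_continuous s : 0 <= s <= T ->
    continuous (fun z : 'cV[R]_d * 'cV[R]_k => F s z.1 z.2).
  move=> sT z; apply: differentiable_continuous.
  by have [[+ _] _] := L_C2 LG (P1 s sT); apply.
have F_time s q x u : 0 <= s <= T -> 0 <= q <= T ->
    `|F s x u - F q x u| <= c * Num.sqrt `|s - q|.
  move=> sT qT; apply: (@le_trans _ _ (cL * K * Num.sqrt `|s - q|)); last first.
    by rewrite ler_wpM2r ?sqrtr_ge0// /c; lra.
  rewrite -lee_fin; apply: le_trans (L_lip x u _ _ (P1 s sT) (P1 q qT)) _.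
  rewrite -mulrA EFinM; apply: lee_wpmul2l; first by rewrite lee_fin.
  exact: (flow_d1 T_gt0 alpha_gt1 etaP).
have F_coercive s x u : 0 <= s <= T -> (4 * c0)^-1 * `|u| ^+ 2 - c <= F s x u.
  move=> sT; have /andP[+ _] := L_bd x u _ (P1 s sT).
  by apply: le_trans; rewrite lerD2l lerN2 /c; lra.
have F_growth s x u : 0 <= s <= T -> F s x u <= c * (1 + `|u| ^+ 2).
  move=> sT; have /andP[_] := L_bd x u _ (P1 s sT).
  move=> /le_trans; apply; rewrite ler_wpM2r ?addr_ge0 ?sqr_ge0// /c; lra.
have F_lipschitz s x y u : 0 <= s <= T ->
    F s x u - F s y u <= c * (1 + `|u| ^+ 2) * `|x - y|.
  (* The two-sided growth bounds make [Q] a bound for the oscillation of L in the state at fixed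
     [u]; semiconcavity turns it into a Lipschitz constant. *)
  move=> sT; pose Q := (lo + hi) * (1 + `|u| ^+ 2).
  have u2 : 0 <= `|u| ^+ 2 := sqr_ge0 _.
  have Q0 : 0 <= Q by rewrite mulr_ge0// addr_ge0.
  have osc y1 y2 : `|F s y1 u - F s y2 u| <= Q.
    have /andP[a1 b1] := L_bd y1 u _ (P1 s sT).
    have /andP[a2 b2] := L_bd y2 u _ (P1 s sT).
    have : 0 <= (4 * c0)^-1 * `|u| ^+ 2.
      by rewrite mulr_ge0// invr_ge0 mulr_ge0// ltW.
    have : 0 <= lo * `|u| ^+ 2 by rewrite mulr_ge0.
    by rewrite ler_norml /Q /F; lra.
  have sc lam x0 x1 (l01 : 0 <= lam <= 1) :=
    proj1 (semiconcave_norm wL0 wG0 LGw (P1 s sT) u x0 x1 l01).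
  apply: le_trans (semiconcave_bounded_lipschitz Q0 wL'0 osc sc y x) _.
  rewrite ler_wpM2r// /Q.
  have : 0 <= (c - lo - hi) * `|u| ^+ 2 by rewrite mulr_ge0// /c; lra.
  have : 2 * wL' <= c - lo - hi by rewrite /c; lra.
  by lra.
have F_semiconcave s x z u : 0 <= s <= T ->
    F s (x + z) u + F s (x - z) u - 2 * F s x u <= c * `|z| ^+ 2.
  move=> sT; have [+ _] := semiconcave_midpoint wL0 wG0 LGw (P1 s sT) u x z.
  by move=> /le_trans; apply; rewrite ler_wpM2r ?sqr_ge0// -/wL' /c; lra.
pose G' x := G x (flow eta T).
have G_bounded x : `|G' x| <= c.
  by apply: le_trans (G_bd x _ (P1 T TT)) _; rewrite /c; lra.
have G_lipschitz x y : G' x - G' y <= c * `|x - y|.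
  have osc y1 y2 : `|G' y1 - G' y2| <= 2 * cG.
    have := G_bd y1 _ (P1 T TT); have := G_bd y2 _ (P1 T TT).
    by rewrite !ler_norml /G'; lra.
  have sc lam x0 x1 (l01 : 0 <= lam <= 1) :=
    proj2 (semiconcave_norm wL0 wG0 LGw (P1 T TT) 0 x0 x1 l01).
  have cG2 : 0 <= 2 * cG by rewrite mulr_ge0.
  apply: le_trans (semiconcave_bounded_lipschitz cG2 wG'0 osc sc y x) _.
  by rewrite ler_wpM2r// /c; lra.
have G_semiconcave x z : G' (x + z) + G' (x - z) - 2 * G' x <= c * `|z| ^+ 2.
  have [_ +] := semiconcave_midpoint wL0 wG0 LGw (P1 T TT) 0 x z.
  by move=> /le_trans; apply; rewrite ler_wpM2r ?sqr_ge0// -/wG' /c; lra.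
have a0_gt0 : 0 < (4 * c0)^-1 by rewrite invr_gt0 mulr_gt0.
have SC := optimal_value_semiconcave_time (ltW T_gt0) a0_gt0 c_ge0 (exp_bound_ge0 A T)
  F_continuous F_time F_coercive F_growth F_lipschitz F_semiconcave
  G_bounded G_lipschitz G_semiconcave (exp_curve_trajectory A B T)
  (@exp_curve_bound _ _ A T) (@exp_curve_drift _ _ A T).
have SC0 := @semiconcavity_const_ge0 _ _ _ A B T (4 * c0)^-1 c (exp_bound A T)
  (ltW T_gt0) a0_gt0 c_ge0 (exp_bound_ge0 A T) rho (ltW rho_gt0).
exists (semiconcavity_const A B T (4 * c0)^-1 c (exp_bound A T) rho) => //.
move=> t x h delta _ xrho tp _ tm _.
apply: le_trans (SC rho t delta x h (ltW rho_gt0) tp tm (le_trans (normr_le_enorm _) xrho)) _.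
(* Back to the Euclidean norm of [h], which dominates the sup norm. *)
rewrite ler_wpM2l// -powR_three_halves// lerD2r.
by rewrite lerXn2r ?nnegrE ?enorm_ge0// normr_le_enorm.
Qed.
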